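(* Let $\alpha\in(0,1)$ and let $f$ be a piecewise $C^{1+\alpha}$ one-dimensional map of $I=[0,1]$, with one-sided singular/discontinuity set $\mathcal{D}$ (finite, each point having a one-sided critical order in $(0,1]$), with monotonous branches on the connected components of $I\setminus\mathcal{D}$, and such that $\inf\{|f'(x)|:x\in I\setminus\mathcal{D}\}>1$. Assume in addition that $\mathcal{S}=\{c\in\mathcal{D}:0<\alpha(c)<1\}\neq\emptyset$ and that discontinuities visit singularities, i.e.: there is $T_0\in\mathbb{Z}^+$ such that for every $c\in\mathcal{D}\setminus\mathcal{S}$ there is a positive integer $T=T(c)\le T_0$ so that $f^T(c)\in\mathcal{S}$; for every $0<j<T$ there is $c_j\in\mathcal{D}\setminus\mathcal{S}$ with $d(f^j(c),\mathcal{D})=d(f^j(c),c_j)>0$; and we can find $\epsilon,\delta>0$ such that $f^T|_{\Delta(c,\delta)}$ is a diffeomorphism into $\Delta(f^T(c),\epsilon)$. Then $f$ has exponentially slow recurrence to the singular/discontinuous subset $\mathcal{D}$, that is, for each $\epsilon>0$ we can find $\delta>0$ so that there exists $\xi>0$ satisfying $$\limsup_{n\to\infty}\frac{1}{n}\log\lambda\left\{t\in I:\frac1n\sum_{j=0}^{n-1}\Delta_{\delta}(f^j(t))>\epsilon\right\}<-\xi ,$$ where $\lambda$ is Lebesgue measure on $I$.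
   Context: A map $f$ of the interval $I=[0,1]$ is piecewise $C^{1+\alpha}$, $\alpha\in(0,1)$, if there is a finite set $\mathcal{C}\subset I$ such that $f$ is (locally) $C^{1+\alpha}$ and monotone on each connected component of $I\setminus\mathcal{C}$ and admits a continuous extension to the boundary, so that the one-sided limits $f(c^\pm)=\lim_{t\to c^\pm}f(t)$ exist for each $c\in\mathcal{C}$. $\mathcal{D}$ is the set of all ''one-sided critical points'' $c^+$ and $c^-$, $c\in\mathcal{C}$ (a generic element is denoted by $c$; for distances and for $I\setminus\mathcal{D}$, its elements are regarded as points of $I$). One-sided neighborhoods are $\Delta(c^+,\delta)=(c,c+\delta)$ and $\Delta(c^-,\delta)=(c-\delta,c)$. For $c\in\mathcal{D}$, $f^j(c)$ denotes the limit of $f^j(t)$ as $t\to c$ within the one-sided neighborhood of $c$, and ''$f^T(c)\in\mathcal{S}$'' is understood for one-sided points. Each $c\in\mathcal{D}$ is assumed to have a well-defined one-sided critical order $0<\alpha(c)\le1$: for some $\delta>0$ and $t\in\Delta(c,\delta)$, $|f(t)-f(c)|\approx|t-c|^{\alpha(c)}$ and $|f'(t)|\approx|t-c|^{\alpha(c)-1}$, where $g\approx h$ means that $g/h$ is bounded above and below (away from $0$) uniformly on the stated domain. For $c\in\mathcal{D}$ with $\alpha(c)=1$ there is moreover a global constant $H$ with $|f'(t)-f'(s)|\le H|t-s|^\alpha$ for $t,s\in\Delta(c,\delta)$. With $d(x,y)=|x-y|$, the smooth $\delta$-truncated distance to $\mathcal{D}$ is $d_\delta(x,\mathcal{D})=d(x,\mathcal{D})$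 if $0<d(x,\mathcal{D})\le\delta$; $d_\delta(x,\mathcal{D})=\frac{1-\delta}{\delta}d(x,\mathcal{D})+2\delta-1$ if $\delta<d(x,\mathcal{D})<2\delta$; and $d_\delta(x,\mathcal{D})=1$ if $d(x,\mathcal{D})\ge2\delta$. Set $\Delta_\delta(x)=|\log d_\delta(x,\mathcal{D})|$. *)

(* Defs.v *)
From mathcomp Require Export all_boot all_order all_algebra.
From mathcomp Require Export all_classical all_reals all_analysis.
Export Order.TTheory GRing.Theory Num.Theory numFieldNormedType.Exports.

Set Implicit Arguments.
Unset Strict Implicit.
Unset Printing Implicit Defensive.

#[global] Open Scope classical_set_scope.
#[global] Open Scope ring_scope.

Section Defs.
Context {R : realType}.
Implicit Types (f g : R -> R) (A C U V : set R) (c : R * bool) (x y d : R).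

Definition unitI : set R := `[0, 1]%classic.

(* Derivative relative to [A]. In the interior of [A] it is the usual
   derivative; at 0 and 1 the derivative relative to [unitI] is one-sided and
   does not involve the values of f outside the interval. *)
Definition derivable_in A f x :=
  cvg ((f y - f x) / (y - x) @[y --> within A x^']).

Definition derive_in A f x : R :=
  lim ((f y - f x) / (y - x) @[y --> within A x^']).

Definition holder_on A (alpha H : R) f :=
  forall s t, A s -> A t -> `|f s - f t| <= H * `|s - t| `^ alpha.

Definition locally_C1holder (alpha : R) f C :=
  forall x, (unitI `\` C) x -> exists H r : R, 0 < r /\
    let U := (unitI `\` C) `&` ball x r in
    (forall y, U y -> derivable_in unitI f y) /\
    holder_on U alpha H (derive_in unitI f).

Definition monotone_on A f :=
  (forall x y, A x -> A y -> x <= y -> f x <= f y) \/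
  (forall x y, A x -> A y -> x <= y -> f y <= f x).

Definition continuous_extension A f :=
  exists g, {within closure A, continuous g} /\ forall x, A x -> g x = f x.

Definition piecewise_C1holder (alpha : R) f C :=
  [/\ forall x, unitI x -> unitI (f x),
      finite_set C,
      C `<=` unitI,
      locally_C1holder alpha f C &
      forall x, (unitI `\` C) x ->
        let J := connected_component (unitI `\` C) x in
        monotone_on J f /\ continuous_extension J f].

(* A one-sided point is a pair: (c, true) is c^+ and (c, false) is c^-. *)
Definition one_sided c : set_system R := if c.2 then c.1^'+ else c.1^'-.

Definition sided_nbhd c d : set R :=
  if c.2 then `]c.1, c.1 + d[%classic else `]c.1 - d, c.1[%classic.

(* The set of one-sided critical points. The inequalities only discard 0^- and
   1^+, whose neighborhoods lie outside the interval, so that the underlying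
   points are exactly those of [C]. *)
Definition critical_points C : set (R * bool) :=
  [set c | C c.1 /\ if c.2 then c.1 < 1 else 0 < c.1].

(* f^j(c); j = 1 is the one-sided limit f(c) *)
Definition iter_lim f j c : R := lim (iter j f t @[t --> one_sided c]).

Definition comparable_on A g h :=
  exists m M : R, 0 < m /\ forall t, A t -> m <= g t / h t <= M.

Definition critical_orders (alpha : R) f C (ord : R * bool -> R) :=
  (forall c, critical_points C c -> 0 < ord c <= 1) /\
  exists H : R, forall c, critical_points C c -> exists d, 0 < d /\
    [/\ comparable_on (sided_nbhd c d)
          (fun t => `|f t - iter_lim f 1 c|) (fun t => `|t - c.1| `^ ord c),
        comparable_on (sided_nbhd c d)
          (fun t => `|derive_in unitI f t|)
          (fun t => `|t - c.1| `^ (ord c - 1)) &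
        ord c = 1 -> holder_on (sided_nbhd c d) alpha H (derive_in unitI f)].

Definition singularities C (ord : R * bool -> R) : set (R * bool) :=
  [set c | critical_points C c /\ 0 < ord c < 1].

Definition dist_crit C x : R :=
  inf [set `|x - c.1| | c in critical_points C].

Definition C1_on U g :=
  forall x, U x -> derivable g x 1 /\ {for x, continuous (derive1 g)}.

Definition diffeo_into U V g :=
  [/\ open U, open (g @` U), g @` U `<=` V, C1_on U g &
      exists h : R -> R,
        C1_on (g @` U) h /\ forall x, U x -> h (g x) = x].

(* [s] is f^T(c) as a one-sided point: its base point is the limit [iter_lim],
   its side is the one from which the images of [sided_nbhd c d] approach. *)
Definition visits_singularities f C (ord : R * bool -> R) :=
  exists T0 : nat, (0 < T0)%N /\
  forall c, (critical_points C `\` singularities C ord) c ->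
  exists T : nat, (0 < T <= T0)%N /\
  exists2 s, singularities C ord s &
  [/\ iter_lim f T c = s.1,
      forall j : nat, (0 < j < T)%N ->
        exists2 cj, (critical_points C `\` singularities C ord) cj &
          dist_crit C (iter_lim f j c) = `|iter_lim f j c - cj.1| /\
          0 < `|iter_lim f j c - cj.1| &
      exists e d, [/\ 0 < e, 0 < d &
        diffeo_into (sided_nbhd c d) (sided_nbhd s e) (iter T f)]].

Definition trunc_dist C (delta : R) x : R :=
  let r := dist_crit C x in
  if r <= delta then r
  else if r < 2 * delta then (1 - delta) / delta * r + 2 * delta - 1
  else 1.

(* On [C] the truncated distance is 0 and, as ln 0 = 0, so is this function;
   the points whose orbits meet [C] form a countable set for the maps at hand,
   so this convention does not affect the measure of sets defined from it. *)
Definition log_trunc_dist C (delta : R) x : R := `|ln (trunc_dist C delta x)|.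

End Defs.

(* Main.v *)
Require Import Defs.
From mathcomp Require Import ring lra.

(** Near a singularity [s] of order a < 1 the derivative is of order
    |t - s|^(a - 1). A visit at distance e^(-r) from [s] therefore contracts
    preimages by e^(-(1 - a) r), and for 0 < kappa < 1 - a the weight
    e^(kappa r) of such a visit is paid by the contraction, with a factor to spare
    that tends to 0 as r grows. This gives, for the total depth S_n of the visits
    before the time n to tiny neighbourhoods of the singularities, tail bounds of
    the form lam {S_n >= s} <= W E^n e^(- kappa s). They are useful at the level
    s = eps n once log E < kappa eps, and the work consists in making E close
    to 1. They are proved by induction on n, pulling back through the first step
    ([high_push]); the measure is used as an outer measure on all subsets of the
    line, through countable subadditivity and its behaviour under expanding maps
    ([lam_expand]).

    Two effects could make E large. Branches cut intervals into short pieces, for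
    which length is not a good measure of size. Following Lasota and Yorke, a piece
    is weighted by its length plus a cost for each of its parts under the cuts of the
    next steps ([weight]). A short piece meets at most one cut of the first m steps,
    while these steps expand by sigma^m >= 2, so the cost of the new end points
    is absorbed ([weighted_growth]).

    The other effect is distortion. Away from the singularities f' is uniformly
    continuous on branches, and after finitely many additional cuts
    ([oscillation_cuts]) the distortion of one step is as close to 1 as desired. Near
    the singularities |f'| is known up to a bounded factor only, so that each visit
    to a neighbourhood of radius d costs a constant ([singular_distortion]). A
    penalty L per visit, subtracted from the depth, compensates it. It changes the
    depth by little unless the visits have a definite frequency, and frequent visits
    are exponentially rare by a crude count: the number of branches is fixed while
    the contraction of a visit tends to 0 with d ([frequent_visits_rare]). The outcome
    is [slow_depth].

    Finally, a critical point of order 1 is followed by its orbit to a singularity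
    within T0 steps, along which [f] is Lipschitz; a point near the former arrives
    equally near to the latter, up to a constant factor. So the depth with respect
    to all critical points is dominated by the depth with respect to the
    singularities at the next T0 times ([critical_shadow]). *)

Set Implicit Arguments.
Unset Strict Implicit.
Unset Printing Implicit Defensive.

(** * Lebesgue outer measure *)

Section OuterMeasure.
Context {R : realType}.
Implicit Types (A B X : set R) (f : R -> R).
Local Notation lam := (@lebesgue_measure R).

Lemma lam_le A B : A `<=` B -> (lam A <= lam B)%E.
Proof. exact: (@le_mu_ext _ _ _ (wlength idfun)). Qed.

Lemma lam_ge0 A : (0 <= lam A)%E.
Proof. exact: (@mu_ext_ge0 _ _ _ (wlength idfun)). Qed.

Lemma lam_set0 : lam set0 = 0%E.
Proof. exact: measure0. Qed.

Lemma lam_bigcup (F : nat -> set R) :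
  (lam (\bigcup_n F n) <= \big[+%E/0%R]_(0 <= i <oo) lam (F i))%E.
Proof. exact: (@mu_ext_sigma_subadditive _ _ _ (wlength idfun)). Qed.

Lemma lam_cover2 X A B (r1 r2 : R) : X `<=` A `|` B ->
  (lam A <= r1%:E)%E -> (lam B <= r2%:E)%E -> (lam X <= (r1 + r2)%:E)%E.
Proof.
move=> XAB Ar Br.
pose F : nat -> set R :=
  fun i => if i == 0%N then A else if i == 1%N then B else set0.
have XF : X `<=` \bigcup_n F n.
  by move=> x /XAB[Ax|Bx]; [exists 0%N|exists 1%N].
apply: le_trans (lam_le XF) _.
apply: le_trans (lam_bigcup F) _.
rewrite (nneseries_split 0%N 2%N); last by move=> k _; exact: lam_ge0.
rewrite add0n eseries0 ?adde0; last first.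
  by move=> [|[|i]]// _ _; rewrite /F/= lam_set0.
rewrite big_nat_recr//= big_nat1 EFinD; exact: leeD.
Qed.

Lemma lam_set1 (x : R) : lam [set x] = 0%E.
Proof. exact: lebesgue_measure_set1. Qed.

Lemma lam_itv (a b : R) : a <= b -> lam `]a, b[%classic = (b - a)%:E.
Proof.
move=> ab; rewrite lebesgue_measure_itv/= lte_fin.
by case: ltP => // ba; rewrite (le_anti (introT andP (conj ab ba))) subrr.
Qed.

Lemma lam_cover_pt X A B (x r1 r2 : R) : X `<=` A `|` B `|` [set x] ->
  (lam A <= r1%:E)%E -> (lam B <= r2%:E)%E -> (lam X <= (r1 + r2)%:E)%E.
Proof.
move=> XAB Ar Br; rewrite -[r1 + r2]addr0.
apply: (lam_cover2 XAB); first exact: lam_cover2 Ar Br.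
by rewrite lam_set1.
Qed.

Lemma lam_split_itv A (a x b r1 r2 : R) : a < x < b ->
  (lam (`]a, x[%classic `&` A) <= r1%:E)%E ->
  (lam (`]x, b[%classic `&` A) <= r2%:E)%E ->
  (lam (`]a, b[%classic `&` A) <= (r1 + r2)%:E)%E.
Proof.
move=> /andP[ax xb] Ar Br; apply: (lam_cover_pt (x := x) _ Ar Br).
move=> t [] /=; rewrite !in_itv/= => /andP[ta tb] At.
have [tx|xt|tx] := ltgtP t x; [left; left|left; right|by right].
  by rewrite ta.
by rewrite tb.
Qed.

Lemma lam_diam X (D : R) : 0 <= D ->
  (forall x y, X x -> X y -> `|x - y| <= D) -> (lam X <= D%:E)%E.
Proof.
move=> D0 XD.
have [->|/set0P [x0 Xx0]] := eqVneq X set0.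
  by rewrite lam_set0 lee_fin.
have hlb : has_lbound X.
  exists (x0 - D) => y Xy; have := XD _ _ Xx0 Xy.
  rewrite ler_norml => /andP[]; lra.
have XI : X `<=` `[inf X, inf X + D]%classic.
  move=> x Xx /=; rewrite in_itv/=; apply/andP; split; first exact: ge_inf.
  rewrite -lerBlDr; apply: lb_le_inf; first by exists x0.
  move=> y Xy; have := XD _ _ Xx Xy.
  rewrite ler_norml => /andP[]; lra.
apply: le_trans (lam_le XI) _.
rewrite lebesgue_measure_itv/= lte_fin.
case: ltP => // _; first by rewrite lee_fin; lra.
Qed.

(** The part of [A] sent into one interval of a cover of [B] has a diameter of at
    most [G] times the length of that interval. *)
Lemma lam_expand f A B (G r : R) : 0 <= G ->
  (forall x y, A x -> A y -> `|x - y| <= G * `|f x - f y|) ->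
  (forall x, A x -> B (f x)) ->
  (lam B <= r%:E)%E -> (lam A <= (G * r)%:E)%E.
Proof.
move=> G0 Af AB Br; apply/lee_addgt0Pr => e e0.
pose e' := e / (G + 1).
have G1 : 0 < G + 1 by lra.
have e'0 : 0 < e' by rewrite divr_gt0.
have : (lam B < (r + e')%:E)%E by apply: (le_lt_trans Br); rewrite lte_fin; lra.
rewrite (_ : lam B = (wlength idfun)^*%mu B)//.
rewrite (@measurable_realfun.outer_measure_open_itv_cover R).
case/ereal_inf_lt => _ [F [Fitv BF] <-] Fr.
have AF : A `<=` \bigcup_n (A `&` f @^-1` (F n)).
  by move=> x Ax; have [n _ Fn] := BF _ (AB _ Ax); exists n.
apply: le_trans (lam_le AF) _.
apply: le_trans (lam_bigcup _) _.
have w0 k : (0 <= wlength (@idfun R) (F k))%E by [].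
apply: (@le_trans _ _ (\big[+%E/0]_(0 <= i <oo) (G%:E * wlength idfun (F i))%E)).
  apply: lee_nneseries => [n _ _|n _]; first exact: lam_ge0.
  have [[a b] /= Fab] := Fitv n.
  have [ab|ba] := ltP a b; last first.
    rewrite Fab (_ : `]a, b[%classic = set0); last by rewrite set_itv_ge// -leNgt.
    by rewrite preimage_set0 setI0 lam_set0 wlength0 mule0.
  rewrite Fab wlength_itv/= lte_fin ab -EFinB -EFinM.
  apply: lam_diam; first by rewrite mulr_ge0//; lra.
  move=> x y [Ax]; rewrite /= in_itv/= => /andP[x1 x2] [Ay].
  rewrite /= in_itv/= => /andP[y1 y2].
  apply: (le_trans (Af _ _ Ax Ay)); apply: ler_wpM2l => //.
  by rewrite ler_norml; apply/andP; split; lra.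
rewrite nneseriesZl//.
apply: (@le_trans _ _ (G%:E * (r + e')%:E)%E).
  by apply: lee_wpmul2l; [rewrite lee_fin|exact: ltW].
rewrite -EFinM -EFinD lee_fin mulrDr lerD2l /e' mulrCA ler_piMr ?(ltW e0)//.
by rewrite ler_pdivrMr//; lra.
Qed.

End OuterMeasure.

(** * Branches of a piecewise smooth map *)

Section RelativeDerivative.
Context {R : realType}.
Implicit Types (f : R -> R) (x y : R).

Lemma derive_in_quotient f x : derivable_in unitI f x ->
  forall e, 0 < e -> exists2 r : R, 0 < r &
    forall y, unitI y -> y != x -> `|y - x| < r ->
      `|(f y - f x) / (y - x) - derive_in unitI f x| < e.
Proof.
rewrite /derivable_in => df e e0.
have {}df : (f y - f x) / (y - x) @[y --> within unitI x^'] -->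
  derive_in unitI f x by exact: df.
move/cvgrPdist_lt/(_ _ e0) : df => [r /= r0 H]; exists r => // y Iy yx yxr.
by rewrite distrC; apply: H => //=; rewrite distrC.
Qed.

Lemma derive_in_is_derive f x : 0 < x < 1 -> derivable_in unitI f x ->
  is_derive x 1 f (derive_in unitI f x).
Proof.
move=> /andP[x0 x1] df.
have H : h^-1 *: ((f \o shift x) (h *: (1:R)) - f x) @[h --> 0^'] -->
    derive_in unitI f x.
  apply/cvgrPdist_lt => e e0.
  have [r r0 Hr] := derive_in_quotient df e0.
  near=> h.
  have h0 : h != 0 by near: h; exact: nbhs_dnbhs_neq.
  have hr : `|h| < Num.min r (Num.min x (1 - x)).
    near: h; apply: dnbhs0_lt; rewrite !lt_min r0 x0/=; lra.
  move: hr; rewrite !lt_min => /andP[hr /andP[hx h1]].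
  rewrite distrC /= scaler1.
  have -> : h^-1 *: (f (h + x) - f x) = (f (h + x) - f x) / ((h + x) - x).
    by rewrite addrK /GRing.scale/= mulrC.
  have /andP[a1 a2] : - x < h < x by rewrite -ltr_norml.
  have /andP[a3 a4] : - (1 - x) < h < 1 - x by rewrite -ltr_norml.
  apply: Hr.
  - by rewrite /unitI/= in_itv/=; apply/andP; split; lra.
  - by rewrite -subr_eq0 addrK.
  - by rewrite addrK.
split; first by apply/cvg_ex; exists (derive_in unitI f x).
exact: cvg_lim H.
Unshelve. all: by end_near. Qed.

Lemma derive_in_lipschitz f x : derivable_in unitI f x ->
  exists K r : R, [/\ 0 < K, 0 < r &
    forall y, unitI y -> `|y - x| < r -> `|f y - f x| <= K * `|y - x|].
Proof.
move=> df; have [r r0 H] := derive_in_quotient df ltr01.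
exists (`|derive_in unitI f x| + 1), r; split => //.
move=> y Iy yr; have [->|yx] := eqVneq y x; first by rewrite !subrr normr0 mulr0.
have yx0 : 0 < `|y - x| by rewrite normr_gt0 subr_eq0.
rewrite -ler_pdivrMr// -normf_div.
have := H _ Iy yx yr; move: (_ / _) (derive_in _ _ _) => q l ql.
by have := ler_normD (q - l) l; rewrite subrK; lra.
Qed.

End RelativeDerivative.

Section Branch.
Context {R : realType} (f : R -> R) (C : set R) (alpha : R).
Context (Hf : piecewise_C1holder alpha f C).
Local Notation df := (derive_in unitI f).

(** All pieces are open intervals, known by their end points: splitting a piece
    at a cut loses only that cut, a null set. *)
Definition uncut (A : set R) (a b : R) :=
  [/\ 0 <= a, b <= 1 & forall x, a < x < b -> ~ A x].

Lemma unitI_mem (x : R) : unitI x <-> 0 <= x <= 1.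
Proof. by rewrite /unitI/= in_itv. Qed.

Lemma uncutP a b x : uncut C a b -> a < x < b -> (unitI `\` C) x.
Proof.
move=> [a0 b1 H] abx; split; last exact: H.
by apply/unitI_mem; lra.
Qed.

Lemma off_cut_derivable x : (unitI `\` C) x -> derivable_in unitI f x.
Proof.
move=> Ix; case: Hf => _ _ _ /(_ x Ix)[H [r [r0 [Hd _]]]] _.
by apply: Hd; split => //; exact: ballxx.
Qed.

Lemma uncut_is_derive a b x : uncut C a b -> a < x < b -> is_derive x 1 f (df x).
Proof.
move=> abC xab; apply: derive_in_is_derive; first by case: abC => *; lra.
exact/off_cut_derivable/(uncutP abC).
Qed.

Lemma uncut_continuous a b x y : uncut C a b -> a < x -> y < b ->
  {within `[x, y], continuous f}.
Proof.
move=> abC ax yb; apply: derivable_within_continuous => z; rewrite in_itv/= => xzy.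
have zab : a < z < b by lra.
by case: (uncut_is_derive abC zab).
Qed.

Lemma uncut_MVT a b x y : uncut C a b -> a < x -> x < y -> y < b ->
  exists2 z, x < z < y & f y - f x = df z * (y - x).
Proof.
move=> abC ax xy yb.
have [|z|z] := @MVT R f df x y xy.
- move=> z; rewrite in_itv/= => xzy; apply: (uncut_is_derive abC); lra.
- exact: (uncut_continuous abC).
- by rewrite in_itv/= => xzy fxy; exists z.
Qed.

Lemma uncut_MVT_norm a b x y : uncut C a b -> a < x < b -> a < y < b ->
  x != y ->
  exists2 z, (x < z < y) || (y < z < x) & `|f x - f y| = `|df z| * `|x - y|.
Proof.
move=> abC xab yab xy.
have [lt|lt|] := ltgtP x y; last by move/eqP : xy.
- have [||z zxy fe] := uncut_MVT abC _ lt _; [lra|lra|].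
  by exists z; rewrite ?zxy// distrC fe normrM distrC.
- have [||z zxy fe] := uncut_MVT abC _ lt _; [lra|lra|].
  by exists z; rewrite ?zxy ?orbT// fe normrM.
Qed.

Lemma uncut_monotone a b : uncut C a b -> monotone_on `]a, b[%classic f.
Proof.
move=> abC; have [ab|ba] := ltP a b; last first.
  by left => x y; rewrite /= in_itv/= => h; exfalso; move: h; lra.
pose m := (a + b) / 2.
have mab : a < m < b by rewrite /m; lra.
case: Hf => _ _ _ _ /(_ m (uncutP abC mab))/= [Hm _].
have sub : `]a, b[%classic `<=` connected_component (unitI `\` C) m.
  apply: connected_component_max.
  - by rewrite /= in_itv.
  - by move=> x; rewrite /= in_itv/=; exact: uncutP.
  - by apply/connected_intervalP; exact: interval_is_interval.
by case: Hm => H; [left|right] => x y xab yab; apply: H; exact: sub.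
Qed.

Lemma unitI_stable x : unitI x -> unitI (f x).
Proof. by case: Hf => H _ _ _ _; exact: H. Qed.

Context (sigma : R) (sigma1 : 1 < sigma)
  (Hexp : forall x, (unitI `\` C) x -> sigma <= `|df x|).

Lemma uncut_expand a b x y : uncut C a b -> a < x < b -> a < y < b ->
  sigma * `|x - y| <= `|f x - f y|.
Proof.
move=> abC xab yab; have [->|xy] := eqVneq x y; first by rewrite !subrr normr0 mulr0.
have [z zxy ->] := uncut_MVT_norm abC xab yab xy.
apply: ler_wpM2r => //; apply: Hexp; apply: (uncutP abC).
by case/orP: zxy; lra.
Qed.

Lemma uncut_inj a b x y : uncut C a b -> a < x < b -> a < y < b ->
  f x = f y -> x = y.
Proof.
move=> abC xab yab fxy; have := uncut_expand abC xab yab.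
have s0 : 0 < sigma by exact: lt_trans sigma1.
by rewrite fxy subrr normr0 pmulr_rle0// normr_le0 subr_eq0 => /eqP.
Qed.

(** Being injective and monotone, [f] attains no extremum on an open interval, so
    its image is the open interval between its infimum and its supremum. *)
Lemma uncut_image a b : uncut C a b -> a < b ->
  exists al be, [/\ 0 <= al, al < be & be <= 1] /\
    [/\ forall t, a < t < b -> al < f t < be,
    (forall y, al < y < be -> exists2 t, a < t < b & f t = y) &
    forall D, (forall t t', a < t < b -> a < t' < b -> `|f t - f t'| <= D) ->
      be - al <= D].
Proof.
move=> abC ab; pose A : set R := [set f t | t in `]a, b[%classic].
have Aab t : a < t < b -> A (f t) by move=> tab; exists t => //=; rewrite in_itv.
have AI y : A y -> 0 <= y <= 1.
  move=> [t]; rewrite /= in_itv/= => /(uncutP abC)[It _] <-.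
  by apply/unitI_mem; exact: unitI_stable.
pose m := (a + b) / 2.
have mab : a < m < b by rewrite /m; lra.
have hi : has_inf A.
  by split; [exists (f m); exact: Aab|exists 0 => y /AI/andP[]].
have hs : has_sup A.
  by split; [exists (f m); exact: Aab|exists 1 => y /AI/andP[]].
have lo y : A y -> inf A <= y by move=> Ay; apply: ge_inf => //; case: hi.
have up y : A y -> y <= sup A by move=> Ay; apply: ub_le_sup => //; case: hs.
have strict t : a < t < b -> inf A < f t < sup A.
  move=> tab; pose t1 := (a + t) / 2; pose t2 := (t + b) / 2.
  have t1ab : a < t1 < b by rewrite /t1; lra.
  have t2ab : a < t2 < b by rewrite /t2; lra.
  have n1 : f t1 != f t.
    by apply/eqP => /(uncut_inj abC t1ab tab); rewrite /t1; lra.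
  have n2 : f t2 != f t.
    by apply/eqP => /(uncut_inj abC t2ab tab); rewrite /t2; lra.
  have := up _ (Aab _ t1ab); have := up _ (Aab _ t2ab).
  have := lo _ (Aab _ t1ab); have := lo _ (Aab _ t2ab).
  have Imem s : a < s < b -> `]a, b[%classic s by rewrite /= in_itv.
  have l1 : t1 <= t by rewrite /t1; lra.
  have l2 : t <= t2 by rewrite /t2; lra.
  case: (uncut_monotone abC) => mono.
    have := mono _ _ (Imem _ t1ab) (Imem _ tab) l1.
    have := mono _ _ (Imem _ tab) (Imem _ t2ab) l2.
    by rewrite !le_eqVlt eq_sym (negbTE n1) (negbTE n2)/=; lra.
  have := mono _ _ (Imem _ t1ab) (Imem _ tab) l1.
  have := mono _ _ (Imem _ tab) (Imem _ t2ab) l2.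
  by rewrite !le_eqVlt [f t == f t1]eq_sym (negbTE n1) (negbTE n2)/=; lra.
exists (inf A), (sup A); split; split.
- by apply: lb_le_inf; [case: hi|move=> y /AI/andP[]].
- by have := strict _ mab; lra.
- by apply: ge_sup; [case: hs|move=> y /AI/andP[]].
- exact: strict.
- move=> y /andP[y1 y2].
  have yi : 0 < y - inf A by lra.
  have ys : 0 < sup A - y by lra.
  have [_ [t + <-] ty] := inf_adherent yi hi.
  rewrite /= in_itv/= => tab.
  have [_ [t' + <-] t'y] := sup_adherent ys hs.
  rewrite /= in_itv/= => t'ab.
  have {}ty : f t <= y by lra.
  have {}t'y : y <= f t' by lra.
  have [tt|tt] := leP t t'.
    have [||c] := @IVT R f t t' y tt.
    + by apply: (uncut_continuous abC); lra.
    + by rewrite ge_min le_max ty t'y orbT.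
    + by rewrite in_itv/= => ct fc; exists c => //; lra.
  have [||c] := @IVT R f t' t y (ltW tt).
  + by apply: (uncut_continuous abC); lra.
  + by rewrite ge_min le_max ty t'y orbT.
  + by rewrite in_itv/= => ct fc; exists c => //; lra.
- move=> D HD; rewrite lerBlDr; apply: ge_sup; first by case: hs.
  move=> _ [t + <-]; rewrite /= in_itv/= => tab.
  rewrite addrC -lerBlDr; apply: lb_le_inf; first by case: hi.
  move=> _ [t' + <-]; rewrite /= in_itv/= => t'ab.
  by have := HD _ _ tab t'ab; rewrite ler_norml; lra.
Qed.

End Branch.

(** * Cutting intervals and counting visits *)

Section CutCount.
Context {R : realType}.
Implicit Types (F : seq R) (a b x : R).

Definition cuts F a b : nat := count (fun x => a < x < b) F.

Lemma cuts_split F a x b : x \in F -> a < x < b ->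
  (cuts F a x + cuts F x b < cuts F a b)%N.
Proof.
move=> xF axb; rewrite /cuts -count_predUI.
have -> : count (predI (fun y => a < y < x) (fun y => x < y < b)) F = 0%N.
  by apply/eqP; rewrite -leqn0 leqNgt -has_count; apply/hasPn => y _ /=; lra.
rewrite addn0.
elim: F xF => [//|y F IH]; rewrite inE => /orP[/eqP <-|xF] /=.
  rewrite axb !ltxx/= andbF add0n add1n ltnS.
  by apply: sub_count => z /=; lra.
apply: leq_trans (leq_add (leqnn _) (IH xF)).
rewrite addnS ltnS leq_add2r.
case: (boolP (a < y < b)) => [_|ny]; first by case: (_ || _).
by rewrite (_ : _ || _ = false)//; apply/negbTE; move: ny; lra.
Qed.

Lemma cuts_gt0 F a b : (0 < cuts F a b)%N -> exists2 x, x \in F & a < x < b.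
Proof. by rewrite -has_count => /hasP[x]; exists x. Qed.

Lemma cuts0 F a b x : cuts F a b = 0%N -> a < x < b -> x \notin F.
Proof.
move=> F0 axb; apply/negP => xF; have := cuts_split xF axb.
by rewrite F0 ltn0.
Qed.

(** The cuts inside an interval are removed one at a time, so that an additive
    estimate only has to be proved for uncut intervals. *)
Lemma split_ind F (P : R -> R -> Prop) :
  (forall a b, a <= b -> (forall x, a < x < b -> x \notin F) -> P a b) ->
  (forall a x b, a < x < b -> x \in F -> P a x -> P x b -> P a b) ->
  forall a b, a <= b -> P a b.
Proof.
move=> P0 PS a b; move: {2}(cuts F a b) (leqnn (cuts F a b)) => n.
elim: n a b => [|n IH] a b cn ab.
  by apply: P0 => // x; apply: cuts0; apply/eqP; rewrite -leqn0.
have [c0|] := posnP (cuts F a b); first by apply: P0 => // x; exact: cuts0.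
move=> /cuts_gt0 [x xF axb]; have := cuts_split xF axb => lt.
have lt' := leq_trans lt cn.
apply: (PS _ x) => //; apply: IH; try lra.
  exact: leq_trans (leq_addr _ _) lt'.
exact: leq_trans (leq_addl _ _) lt'.
Qed.

Lemma short_cuts F : uniq F ->
  exists2 l : R, 0 < l & forall a b, b - a <= l -> (cuts F a b <= 1)%N.
Proof.
elim: F => [|y F IH] /=; first by exists 1.
move=> /andP[yF /IH [l l0 Hl]].
have [r r0 Hr] : exists2 r : R, 0 < r & forall x, x \in F -> r <= `|x - y|.
  elim: F yF {IH l l0 Hl} => [|z F IH]; first by exists 1.
  rewrite inE negb_or => /andP[yz /IH [r r0 Hr]].
  exists (Num.min r `|z - y|).
    by rewrite lt_min r0/= normr_gt0 subr_eq0 eq_sym.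
  move=> x; rewrite inE => /orP[/eqP ->|/Hr]; first by rewrite ge_min lexx orbT.
  by move=> rx; rewrite ge_min rx.
exists (Num.min l r); first by rewrite lt_min l0.
move=> a b; rewrite le_min => /andP[bal bar]; rewrite /cuts/=.
case: (boolP (a < y < b)) => yab; last by rewrite add0n; exact: Hl.
rewrite add1n ltnS leqNgt -/(cuts F a b); apply/negP => /cuts_gt0[x /Hr rx xab].
have : `|x - y| < r by rewrite ltr_norml; lra.
by rewrite ltNge rx.
Qed.

End CutCount.

Section Recursion.
Context {R : realType} (f : R -> R).
Local Notation lam := (@lebesgue_measure R).

Definition birkhoff (psi : R -> R) n t : R := \sum_(0 <= j < n) psi (iter j f t).

Definition high (psi : R -> R) n (s : R) : set R := [set t | s <= birkhoff psi n t].

Lemma birkhoffS psi n t : birkhoff psi n.+1 t = psi t + birkhoff psi n (f t).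
Proof.
rewrite /birkhoff big_nat_recl//=; congr (_ + _).
by apply: eq_bigr => i _; rewrite -iterS iterSr.
Qed.

(** On [A] the inverse of [f] is Lipschitz with constant [G], which bounds 1/|f'|
    there. *)
Definition expands (G : R) (A : set R) :=
  forall x y, A x -> A y -> `|x - y| <= G * `|f x - f y|.

Lemma expands_sub G (A B : set R) : A `<=` B -> expands G B -> expands G A.
Proof. by move=> AB H x y Ax Ay; apply: H; exact: AB. Qed.

Lemma high_push (A B : set R) psi n s p G r : 0 <= G -> expands G A ->
  (forall x, A x -> psi x <= p) -> (forall x, A x -> B (f x)) ->
  (lam (B `&` high psi n (s - p)) <= r%:E)%E ->
  (lam (A `&` high psi n.+1 s) <= (G * r)%:E)%E.
Proof.
move=> G0 eA Ap AB; apply: (lam_expand (f := f)) => //.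
  by apply: expands_sub eA => x [].
move=> x [Ax]; rewrite /high/= birkhoffS => sx; split; first exact: AB.
by have := Ap _ Ax; lra.
Qed.

Lemma high0 (A : set R) psi s k (r : R) : 0 <= k -> 0 <= r -> (lam A <= r%:E)%E ->
  (lam (A `&` high psi 0 s) <= (expR (- (k * s)) * r)%:E)%E.
Proof.
move=> k0 r0 Ar; have [s0|s0] := leP s 0.
  apply: le_trans (lam_le (@subIsetl _ _ _)) _; apply: le_trans Ar _.
  by rewrite lee_fin ler_peMl// -expR0 ler_expR oppr_ge0 mulr_ge0_le0.
rewrite (_ : _ `&` _ = set0) ?lam_set0.
  by rewrite lee_fin mulr_ge0// expR_ge0.
apply/seteqP; split=> // t []; rewrite /high /birkhoff/= big_nil; lra.
Qed.

Lemma lam_unitI_le (A : set R) (r : R) :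
  (lam (`]0%R, 1%R[%classic `&` A) <= r%:E)%E -> (lam (unitI `&` A) <= r%:E)%E.
Proof.
move=> Ar; rewrite -[r]addr0; apply: (@lam_cover_pt _ _ _ [set 0] 1 _ _ _ Ar).
  move=> t [/unitI_mem It At]; have [t0|t0] := eqVneq t 0; first by left; right.
  have [t1|t1] := eqVneq t 1; first by right.
  left; left; split => //; rewrite /= in_itv/=.
  by rewrite !lt_neqAle eq_sym t0 t1/=.
by rewrite lam_set1.
Qed.

Context (C : set R) (alpha : R) (Hf : piecewise_C1holder alpha f C).
Local Notation df := (derive_in unitI f).
Context (sigma : R) (sigma1 : 1 < sigma)
  (Hexp : forall x, (unitI `\` C) x -> sigma <= `|df x|).

Lemma uncut_expands a b : uncut C a b -> expands sigma^-1 `]a, b[%classic.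
Proof.
move=> abC x y; rewrite /= !in_itv/= => xab yab.
have s0 : 0 < sigma by exact: lt_trans sigma1.
by rewrite ler_pdivlMl//; exact: (uncut_expand Hf Hexp abC).
Qed.

Lemma uncut_image_unitI a b t : uncut C a b -> a < t < b -> unitI (f t).
Proof. by move=> abC /(uncutP abC)[It _]; apply: unitI_stable Hf _ It. Qed.

(** Crude counting: one step cuts an interval into at most [1 + size F] pieces,
    whose images have length at most 1, and a visit contracts preimages by the
    factor [Gs <= expR (- k)]. The bound is of use when [k] is large compared
    with the logarithm of the number of pieces. *)
Lemma visits_rare (chi : R -> R) (F : seq R) (Gs k : R) :
  (forall x, C x -> x \in F) -> (forall t, chi t <= 1) ->
  (forall a b, uncut [set` F] a b ->
     (forall t, a < t < b -> chi t <= 0) \/ expands Gs `]a, b[%classic) ->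
  0 <= Gs -> 0 <= k -> expR k * Gs <= 1 ->
  forall n s, (lam (unitI `&` high chi n s) <=
     (expR (- (k * s)) * (1 + (size F)%:R) ^+ n)%:E)%E.
Proof.
move=> CF chi1 HF Gs0 k0 kGs; elim=> [|n IH] s.
  rewrite expr0; apply: high0 => //.
  rewrite lebesgue_measure_itv/= lte_fin ltr01 -EFinB lee_fin; lra.
set Y := expR (- (k * s)) * (1 + (size F)%:R) ^+ n.
have Y0 : 0 <= Y by rewrite mulr_ge0 ?expR_ge0// exprn_ge0// addr_ge0.
suff H a b : a <= b -> 0 <= a -> b <= 1 ->
    (lam (`]a, b[%classic `&` high chi n.+1 s) <= ((1 + (cuts F a b)%:R) * Y)%:E)%E.
  apply: lam_unitI_le; apply: le_trans (H _ _ _ _ _) _ => //.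
  rewrite lee_fin exprSr mulrA -/Y mulrC ler_wpM2l// lerD2l ler_nat.
  exact: count_size.
elim/(split_ind (F := F)): a b / => [a b ab uF a0 b1|a x b axb xF Hax Hxb a0 b1].
  have abF : uncut [set` F] a b by split=> // x /uF /negP.
  have abC : uncut C a b by split=> // x /uF /negP nxF /CF.
  have im t : `]a, b[%classic t -> unitI (f t).
    by rewrite /= in_itv/= => tab; exact: uncut_image_unitI abC tab.
  have Yc : Y <= (1 + (cuts F a b)%:R) * Y by rewrite ler_peMl// lerDl.
  case: (HF _ _ abF) => [chi0|eG].
    have e1 : expands 1 `]a, b[%classic.
      move=> x y xab yab; apply: le_trans (uncut_expands abC xab yab) _.
      by apply: ler_wpM2r => //; rewrite invf_le1 ?ltW//; exact: lt_trans sigma1.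
    have := high_push (n := n) (s := s) ler01 e1 _ im.
    move=> /(_ chi 0 Y); rewrite subr0 => H; apply: le_trans (H _ _) _.
    + by move=> t; rewrite /= in_itv/=; exact: chi0.
    + exact: IH.
    + by rewrite mul1r lee_fin.
  have := high_push (n := n) (s := s) (psi := chi) (p := 1) Gs0 eG _ im.
  move=> H; apply: le_trans (H _ _ (IH _)) _ => //.
  rewrite lee_fin; apply: le_trans Yc.
  have -> : - (k * (s - 1)) = k + - (k * s) by ring.
  rewrite expRD -mulrA -/Y mulrA mulrC ler_piMr// mulrC.
  by [].
apply: (@le_trans _ _ ((1 + (cuts F a x)%:R) * Y + (1 + (cuts F x b)%:R) * Y)%:E).
  by apply: (lam_split_itv axb (Hax _ _) (Hxb _ _)); lra.
rewrite lee_fin -mulrDl; apply: ler_wpM2r => //.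
have := cuts_split xF axb; rewrite -(ler_nat R) -addn1 !natrD; lra.
Qed.

End Recursion.

(** * Deep excursions towards a singularity *)

Section Deep.
Context {R : realType} (f : R -> R).
Local Notation lam := (@lebesgue_measure R).

Lemma sided_nbhdP (s : R * bool) (d t : R) :
  sided_nbhd s d t <-> (if s.2 then s.1 < t else t < s.1) /\ `|t - s.1| < d.
Proof.
rewrite /sided_nbhd; case: s => s [] /=; rewrite in_itv/=.
  split=> [/andP[st td]|[st]]; last by rewrite gtr0_norm ?subr_gt0//; lra.
  by split=> //; rewrite gtr0_norm ?subr_gt0//; lra.
split=> [/andP[st td]|[st]]; last by rewrite ltr0_norm ?subr_lt0//; lra.
by split=> //; rewrite ltr0_norm ?subr_lt0//; lra.
Qed.

Lemma sided_nbhd_gt0 (s : R * bool) (d t : R) : sided_nbhd s d t -> 0 < `|t - s.1|.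
Proof.
move=> /sided_nbhdP[st _]; rewrite normr_gt0 subr_eq0.
by apply/eqP => ts; move: st; rewrite ts ltxx; case: s.2.
Qed.

Lemma sided_nbhd_le (s : R * bool) (d d' : R) : d <= d' ->
  sided_nbhd s d `<=` sided_nbhd s d'.
Proof.
move=> dd t /sided_nbhdP[st td]; apply/sided_nbhdP; split=> //.
exact: lt_le_trans dd.
Qed.

Lemma lam_sided_nbhd (s : R * bool) (d : R) : 0 <= d ->
  (lam (sided_nbhd s d) <= d%:E)%E.
Proof.
move=> d0; rewrite /sided_nbhd; case: s.2; rewrite lam_itv ?lee_fin; lra.
Qed.

(** Whatever the constant [Z] of an exponential tail bound for [n] steps, a first
    step from [D] multiplies it by [eta]. Thus [D], even though [psi] may be
    unbounded on it, contributes little to the tail bound for [n.+1] steps. *)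
Definition negligible_set (psi : R -> R) (kappa eta : R) (D : set R) :=
  forall n Z, 0 <= Z ->
  (forall s, (lam (unitI `&` high f psi n s) <= (expR (- (kappa * s)) * Z)%:E)%E) ->
  forall s, (lam (D `&` high f psi n.+1 s) <= (expR (- (kappa * s)) * Z * eta)%:E)%E.

Lemma negligible_set0 psi kappa eta : 0 <= eta -> negligible_set psi kappa eta set0.
Proof.
move=> eta0 n Z Z0 _ s; rewrite set0I lam_set0 lee_fin.
by rewrite mulr_ge0// mulr_ge0// expR_ge0.
Qed.

(** On the shell x/2 <= |t - s0| < x the weight [expR (kappa * psi t)] is at most
    (x/2)^(-kappa) and lengths of preimages shrink by Q x^beta. As kappa < beta,
    the product, of order x^(beta - kappa), is summable over the dyadic shells
    that fill the neighbourhood. *)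
Lemma deep_negligible (psi : R -> R) (s0 : R * bool) (d Q beta kappa : R) :
  0 < kappa < beta -> 0 < Q -> 0 < d ->
  (forall x, 0 < x <= d -> expands f (Q * x `^ beta) (sided_nbhd s0 x)) ->
  (forall t, sided_nbhd s0 d t -> psi t <= - ln `|t - s0.1|) ->
  (forall t, sided_nbhd s0 d t -> unitI (f t)) ->
  negligible_set psi kappa
    (Q * 2 `^ kappa / (1 - 2 `^ (kappa - beta)) * d `^ (beta - kappa))
    (sided_nbhd s0 d).
Proof.
move=> /andP[k0 kb] Q0 d0 eQ psile fI n Z Z0 IH s.
set q := 2 `^ (kappa - beta).
have q1 : q < 1.
  have ln2 : 0 < ln (2 : R) by rewrite ln_gt0// ltr1n.
  rewrite /q /powR pnatr_eq0/= -[ltRHS]expR0 ltr_expR pmulr_llt0//; lra.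
set Y := expR (- (kappa * s)) * Z.
have Y0 : 0 <= Y by rewrite mulr_ge0 ?expR_ge0.
set A := Y * (Q * 2 `^ kappa) / (1 - q).
have A0 : 0 <= A.
  by rewrite divr_ge0 ?mulr_ge0 ?powR_ge0//; lra.
have AE : A * (1 - q) = Y * (Q * 2 `^ kappa) by rewrite /A divfK//; lra.
(* After N halvings the remaining neighbourhood is estimated by its length. *)
have main N x : 0 < x <= d ->
    (lam (sided_nbhd s0 x `&` high f psi n.+1 s) <=
      (A * x `^ (beta - kappa) + x / 2 ^+ N)%:E)%E.
  elim: N x => [|N IHN] x /andP[x0 xd].
    apply: le_trans (lam_le (@subIsetl _ _ _)) _.
    apply: le_trans (lam_sided_nbhd _ (ltW x0)) _.
    by rewrite lee_fin expr0 divr1 lerDr mulr_ge0// powR_ge0.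
  pose U := sided_nbhd s0 x `&` [set t | x / 2 <= `|t - s0.1|].
  have x2 : 0 < x / 2 <= d by lra.
  pose p := - ln (x / 2).
  have Uh : (lam (U `&` high f psi n.+1 s) <=
      (Q * x `^ beta * (expR (- (kappa * (s - p))) * Z))%:E)%E.
    apply: (high_push (B := unitI) (p := p)).
    - by rewrite mulr_ge0 ?powR_ge0// ltW.
    - apply: (expands_sub (B := sided_nbhd s0 x)); first by move=> t [].
      by apply: eQ; rewrite x0.
    - move=> t [Vt /= xt]; apply: le_trans (psile _ (sided_nbhd_le xd Vt)) _.
      by rewrite lerN2 ler_ln// posrE; [lra|exact: sided_nbhd_gt0 Vt].
    - by move=> t [Vt _]; apply: fI; exact: sided_nbhd_le xd _ Vt.
    - exact: IH.
  have := IHN _ x2 => Lh.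
  apply: (le_trans (lam_cover2 _ Uh Lh)).
    move=> t [Vt ht]; have [xt|tx] := leP (x / 2) `|t - s0.1|; first by left.
    by right; split=> //; apply/sided_nbhdP; split=> //; case/sided_nbhdP: Vt.
  rewrite lee_fin le_eqVlt; apply/orP; left; apply/eqP.
  have -> : expR (- (kappa * (s - p))) * Z = Y * expR (kappa * p).
    rewrite /Y mulrAC -expRD; congr (expR _ * _); ring.
  have l2 : ln (x / 2) = ln x - ln 2 by rewrite ln_div// posrE.
  have E1 : x `^ beta * expR (kappa * p) = 2 `^ kappa * x `^ (beta - kappa).
    rewrite /powR (gt_eqF x0) pnatr_eq0/= -!expRD /p l2; congr expR; ring.
  have E2 : (x / 2) `^ (beta - kappa) = x `^ (beta - kappa) * q.
    rewrite /q /powR !gt_eqF//=; last lra.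
    rewrite -expRD l2; congr expR; ring.
  have -> : Q * x `^ beta * (Y * expR (kappa * p)) =
    Y * (Q * 2 `^ kappa) * x `^ (beta - kappa).
    transitivity (Q * Y * (x `^ beta * expR (kappa * p))); first by ring.
    by rewrite E1; ring.
  by rewrite -AE E2 exprS invfM; ring.
have dd : 0 < d <= d by rewrite d0 lexx.
have -> : expR (- (kappa * s)) * Z *
    (Q * 2 `^ kappa / (1 - q) * d `^ (beta - kappa)) = A * d `^ (beta - kappa).
  by rewrite /A /Y; ring.
apply/lee_addgt0Pr => e e0.
have [N NE] : exists N : nat, d / e < N%:R.
  by exists (Num.truncn (d / e)).+1; rewrite truncnS_gt.
apply: le_trans (main N _ dd) _; rewrite -EFinD lee_fin lerD2l.
rewrite ler_pdivrMr ?exprn_gt0// -ler_pdivrMl// mulrC.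
apply: le_trans (ltW NE) _; rewrite -natrX ler_nat; apply: ltnW; exact: ltn_expl.
Qed.

End Deep.

(** * Growth of standard intervals *)

Section Tower.
Context {R : realType} (f : R -> R).
Local Notation lam := (@lebesgue_measure R).
Context (C : set R) (alpha : R) (Hf : piecewise_C1holder alpha f C).
Local Notation df := (derive_in unitI f).
Context (sigma : R) (sigma1 : 1 < sigma)
  (Hexp : forall x, (unitI `\` C) x -> sigma <= `|df x|).

(** [Ck k] contains the points whose orbit meets [cut] within [k] steps. *)
Definition cut_tower (cut : seq R) (Ck : nat -> seq R) :=
  [/\ Ck 0%N = [::], forall k, uniq (Ck k),
    forall k x, x \in cut -> x \in Ck k.+1 &
    forall k x, unitI x -> f x \in Ck k -> x \in Ck k.+1].

Lemma cuts_image cut Ck k a b al be : cut_tower cut Ck -> uncut C a b ->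
  (forall y, al < y < be -> exists2 t, a < t < b & f t = y) ->
  (cuts (Ck k) al be <= cuts (Ck k.+1) a b)%N.
Proof.
move=> [_ uCk _ pre] abC img.
rewrite /cuts -!size_filter -[X in (_ <= X)%N](size_map f).
apply: uniq_leq_size; first exact: filter_uniq (uCk k).
move=> y; rewrite mem_filter => /andP[yab yC].
have [t tab fty] := img _ yab; apply/mapP; exists t => //.
rewrite mem_filter tab/=; apply: pre; last by rewrite fty.
by case: (uncutP abC tab).
Qed.

(** The length of the interval plus a cost for each piece into which the cuts of
    the next [k] steps will divide it. The cost grows by the factor [sigma] at
    each of the [m] steps of a cycle, which is exactly what the expansion pays. *)
Definition weight (Ck : nat -> seq R) (B : R) m k (a b : R) :=
  (b - a) + B * sigma ^+ (m - k) * (1 + (cuts (Ck k) a b)%:R).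

(** What one step has to provide on an uncut interval: up to the factor [E1] the
    contraction [G] of preimages and the reward [p] of the potential compensate
    the growth of length, except on a set [D] that is negligible. *)
Definition step_bound (psi : R -> R) (kappa E1 eta : R) (a b : R) :=
  exists G p : R, exists D : set R, [/\ 0 < G, G * sigma <= 1 & p <= 0] /\
    [/\ expands f G `]a, b[%classic,
      forall x y, a < x < b -> a < y < b ->
        expR (kappa * p) * G * `|f x - f y| <= E1 * (b - a),
      forall t, a < t < b -> psi t <= p \/ D t &
      negligible_set f psi kappa eta D].

(** By induction on [n], the bound E^n e^(- kappa s) times [weight] holds for every
    interval and every position [k] in the cycle. For [k > 0] the weight is
    additive under cutting, so uncut intervals suffice, where [step_bound]
    applies. For [k = 0] the interval is chopped into pieces of length [l]; such
    a piece meets at most one cut of the next [m] steps, hence costs 2 B, and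
    2 <= sigma^m allows the cycle to start afresh. Chopping is cheap because
    2 B is at most [e1] times the length [l] of a piece. *)
Lemma weighted_growth psi cut Ck m kappa E1 e1 B l eta :
  (forall x, C x -> x \in cut) -> cut_tower cut Ck ->
  (forall a b, b - a <= l -> (cuts (Ck m) a b <= 1)%N) ->
  2 <= sigma ^+ m -> 0 <= kappa -> 0 < e1 -> 1 + e1 <= E1 -> 0 < B -> 0 < l ->
  2 * B <= e1 * l -> eta * (1 + B * sigma ^+ m) <= e1 * B ->
  (forall a b, uncut [set` cut] a b -> a < b -> step_bound psi kappa E1 eta a b) ->
  forall n s, (lam (unitI `&` high f psi n s) <=
    (expR (- (kappa * s)) * ((E1 * (1 + e1)) ^+ n * (1 + B * sigma ^+ m)))%:E)%E.
Proof.
move=> Ccut tower lP sm k0 e10 E1e B0 l0 Bl etaB step.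
have s0 : 0 < sigma by exact: lt_trans sigma1.
have E10 : 0 < E1 by lra.
pose E := E1 * (1 + e1).
have E0 : 0 < E by rewrite mulr_gt0//; lra.
have [Ck0 uCk cutC preC] := tower.
have m0 : (0 < m)%N.
  by rewrite lt0n; apply: contraTneq sm => ->; rewrite expr0 -ltNge ltr1n.
suff main n : forall k a b s, (k <= m)%N -> 0 <= a -> a <= b -> b <= 1 ->
    (lam (`]a, b[%classic `&` high f psi n s) <=
      (expR (- (kappa * s)) * E ^+ n * weight Ck B m k a b)%:E)%E.
  move=> n s; apply: lam_unitI_le; have := @main n 0%N 0 1 s.
  by rewrite /weight Ck0 /cuts/= subn0 addr0 mulr1 subr0 mulrA; exact.
have wge k a b : a <= b -> B <= weight Ck B m k a b.
  move=> ab; have : B <= B * sigma ^+ (m - k) * (1 + (cuts (Ck k) a b)%:R).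
    rewrite -mulrA ler_peMr//; first lra.
    by rewrite mulr_ege1 ?lerDl// exprn_ege1// ltW.
  by rewrite /weight; lra.
have wge0 k a b : a <= b -> 0 <= weight Ck B m k a b.
  by move=> ab; apply: le_trans (wge _ _ _ ab); exact: ltW.
elim: n => [|n IHn] k a b s km a0 ab b1.
  rewrite expr0 mulr1; apply: high0 => //.
    exact: wge0.
  rewrite lam_itv// lee_fin /weight lerDl.
  by rewrite !mulr_ge0 ?exprn_ge0 ?addr_ge0// ltW.
set Y := expR (- (kappa * s)) * E ^+ n.
have Y0 : 0 <= Y by rewrite mulr_ge0 ?expR_ge0// exprn_ge0// ltW.
have IHI s' : (lam (unitI `&` high f psi n s') <=
    (expR (- (kappa * s')) * (E ^+ n * (1 + B * sigma ^+ m)))%:E)%E.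
  apply: lam_unitI_le; have := @IHn 0%N 0 1 s'.
  by rewrite /weight Ck0 /cuts/= subn0 addr0 mulr1 subr0 mulrA; exact.
have pos k' a' b' : (k' < m)%N -> 0 <= a' -> a' <= b' -> b' <= 1 ->
    (lam (`]a', b'[%classic `&` high f psi n.+1 s) <=
      (Y * E1 * weight Ck B m k'.+1 a' b')%:E)%E.
  move=> km' a'0 a'b' b'1; move: a'b' a'0 b'1.
  apply: (@split_ind _ cut (fun a' b' => 0 <= a' -> b' <= 1 ->
    (lam (`]a', b'[%classic `&` high f psi n.+1 s) <=
      (Y * E1 * weight Ck B m k'.+1 a' b')%:E)%E)) => {a b a0 ab b1 a' b'}.
    move=> a b ab uF a0 b1.
    have YW0 : 0 <= Y * E1 * weight Ck B m k'.+1 a b.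
      exact: mulr_ge0 (mulr_ge0 Y0 (ltW E10)) (wge0 _ _ _ ab).
    move: ab; rewrite le_eqVlt => /orP[/eqP ab|ab].
      by rewrite -[X in `]a, X[%classic]ab set_itvoo0 set0I lam_set0 lee_fin.
    have abF : uncut [set` cut] a b by split=> // x /uF /negP.
    have abC : uncut C a b by split=> // x /uF /negP nxF /Ccut.
    have [G [p [D [[G0 Gs p0] [eG dist psip negD]]]]] := step _ _ abF ab.
    have [al [be [[al0 albe be1] [fab img diam]]]] := 
      uncut_image Hf sigma1 Hexp abC ab.
    have cimg := cuts_image k' tower abC img.
    pose A := `]a, b[%classic `&` [set t | psi t <= p].
    have wlen : expR (kappa * p) * G * (be - al) <= E1 * (b - a).
      rewrite -ler_pdivlMl ?mulr_gt0 ?expR_gt0//; apply: diam => t t' tab t'ab.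
      by rewrite ler_pdivlMl ?mulr_gt0 ?expR_gt0//; exact: dist.
    have Ah : (lam (A `&` high f psi n.+1 s) <=
       (G * (expR (- (kappa * (s - p))) * E ^+ n * weight Ck B m k' al be))%:E)%E.
      apply: (high_push (B := `]al, be[%classic) (p := p)); first exact: ltW.
      - by apply: expands_sub eG => t [].
      - by move=> t [].
      - by move=> t []; rewrite /= !in_itv/= => tab _; exact: fab.
      - by apply: IHn => //; [exact: ltnW|exact: ltW].
    have Z0 : 0 <= E ^+ n * (1 + B * sigma ^+ m).
      by rewrite mulr_ge0 ?exprn_ge0 ?(ltW E0)// addr_ge0// mulr_ge0 ?exprn_ge0//
        ltW.
    have Dh := negD _ _ Z0 IHI s.
    apply: (le_trans (lam_cover2 _ Ah Dh)).
      move=> t [tab ht].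
      have [|tp|Dt] := psip t; first by move: tab; rewrite /= in_itv.
        by left.
      by right.
    rewrite lee_fin.
    have -> : expR (- (kappa * (s - p))) * E ^+ n = Y * expR (kappa * p).
      rewrite /Y mulrAC -expRD; congr (expR _ * _); ring.
    have -> : G * (Y * expR (kappa * p) * weight Ck B m k' al be) +
       expR (- (kappa * s)) * (E ^+ n * (1 + B * sigma ^+ m)) * eta =
       Y * (expR (kappa * p) * G * weight Ck B m k' al be +
            eta * (1 + B * sigma ^+ m)).
      by rewrite /Y; ring.
    rewrite -[leRHS]mulrA; apply: ler_wpM2l => //.
    have smE : sigma ^+ (m - k') = sigma * sigma ^+ (m - k'.+1).
      by rewrite -exprS -subSn// subSS.
    set T := B * sigma ^+ (m - k'.+1) * (1 + (cuts (Ck k'.+1) a b)%:R).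
    have TB : B <= T.
      rewrite /T -mulrA ler_peMr//; first lra.
      by rewrite mulr_ege1 ?lerDl// exprn_ege1// ltW.
    have cimg' : B * sigma ^+ (m - k'.+1) * (1 + (cuts (Ck k') al be)%:R) <= T.
      apply: ler_wpM2l; first by rewrite mulr_ge0 ?exprn_ge0 ?ltW.
      by rewrite lerD2l ler_nat.
    have term2 : expR (kappa * p) * G *
        (B * sigma ^+ (m - k') * (1 + (cuts (Ck k') al be)%:R)) <= T.
      rewrite smE.
      have -> : expR (kappa * p) * G *
        (B * (sigma * sigma ^+ (m - k'.+1)) * (1 + (cuts (Ck k') al be)%:R)) =
        (expR (kappa * p) * (G * sigma)) *
        (B * sigma ^+ (m - k'.+1) * (1 + (cuts (Ck k') al be)%:R)) by ring.
      apply: le_trans cimg'; rewrite ler_piMl//.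
        by rewrite !mulr_ge0 ?exprn_ge0 ?addr_ge0// ltW.
      apply: mulr_ile1 => //.
        by rewrite mulr_ge0 ?(ltW G0) ?(ltW s0).
      have : kappa * p <= 0 by rewrite mulr_ge0_le0.
      by rewrite -ler_expR expR0.
    rewrite /weight -/T mulrDr.
    have TE : T + e1 * B <= E1 * T.
      apply: (@le_trans _ _ ((1 + e1) * T)); last by rewrite ler_wpM2r//; lra.
      by rewrite mulrDl mul1r lerD2l ler_wpM2l//; lra.
    by rewrite mulrDr; lra.
  move=> a x b axb xF Hax Hxb a0 b1.
  apply: (@le_trans _ _ (Y * E1 * weight Ck B m k'.+1 a x +
                         Y * E1 * weight Ck B m k'.+1 x b)%:E).
    have [ax xb] := andP axb.
    apply: (lam_split_itv axb (Hax a0 _) (Hxb _ b1)).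
      exact: le_trans (ltW xb) b1.
    exact: le_trans a0 (ltW ax).
  rewrite lee_fin -mulrDr; apply: ler_wpM2l; first by rewrite mulr_ge0// ltW.
  rewrite /weight.
  have cle : 1 + (cuts (Ck k'.+1) a x)%:R + (1 + (cuts (Ck k'.+1) x b)%:R) <=
      1 + (cuts (Ck k'.+1) a b)%:R :> R.
    have := cuts_split (cutC k' _ xF) axb; rewrite -(ler_nat R) -addn1 !natrD; lra.
  have q0 : 0 <= B * sigma ^+ (m - k'.+1) by rewrite mulr_ge0 ?exprn_ge0 ?ltW.
  by have := ler_wpM2l q0 cle; rewrite mulrDr; lra.
case: k km => [_|k km]; last first.
  apply: le_trans (pos _ _ _ km a0 ab b1) _.
  rewrite lee_fin exprSr mulrA -/Y; apply: ler_wpM2r.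
    exact: wge0.
  apply: ler_wpM2l => //; rewrite /E ler_peMr//; lra.
case: m => [|m'] in sm m0 pos wge wge0 lP IHn IHI etaB *; first by [].
have short a' b' : b' - a' <= l -> 0 <= a' -> a' <= b' -> b' <= 1 ->
    (lam (`]a', b'[%classic `&` high f psi n.+1 s) <=
      (Y * E1 * ((b' - a') + 2 * B))%:E)%E.
  move=> lab a'0 a'b' b'1; apply: le_trans (pos _ _ _ (ltnSn _) a'0 a'b' b'1) _.
  rewrite lee_fin; apply: ler_wpM2l; first by rewrite mulr_ge0// ltW.
  rewrite /weight subnn expr0 mulr1 lerD2l mulrC; apply: ler_wpM2r; first exact: ltW.
  have := lP _ _ lab; rewrite -(ler_nat R); lra.
have chop N : forall a' b', b' - a' <= l * N.+1%:R ->
    0 <= a' -> a' <= b' -> b' <= 1 ->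
    (lam (`]a', b'[%classic `&` high f psi n.+1 s) <=
      (Y * E1 * ((1 + e1) * (b' - a') + B * sigma ^+ m'.+1))%:E)%E.
  elim: N => [|N IHN] a' b' lab a'0 a'b' b'1.
    apply: le_trans (short _ _ _ a'0 a'b' b'1) _; first by rewrite mulr1 in lab.
    rewrite lee_fin; apply: ler_wpM2l; first by rewrite mulr_ge0// ltW.
    apply: lerD; first by rewrite ler_peMl//; lra.
    by rewrite mulrC ler_wpM2l// ltW.
  have [lt|lt] := leP (b' - a') l.
    apply: IHN => //; apply: le_trans lt _.
    by rewrite ler_peMr ?(ltW l0)// -[leLHS]/(1%:R) ler_nat.
  have axb : a' < a' + l < b' by rewrite ltrDl l0 addrC -ltrBrDr.
  have [/ltW ax /ltW xb] := andP axb.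
  have la : a' + l - a' <= l by rewrite addrC addKr.
  have lb : b' - (a' + l) <= l * N.+1%:R.
    by rewrite opprD addrA lerBlDr (le_trans lab)// -(natr1 N.+1) mulrDr mulr1.
  have h1 := short _ _ la a'0 ax (le_trans xb b'1).
  have h2 := IHN _ _ lb (le_trans a'0 ax) xb b'1.
  apply: (le_trans (lam_split_itv axb h1 h2)).
  rewrite lee_fin -mulrDr; apply: ler_wpM2l; first by rewrite mulr_ge0// ltW.
  lra.
have [N NE] : exists N : nat, (b - a) / l < N%:R.
  by exists (Num.truncn ((b - a) / l)).+1; rewrite truncnS_gt.
apply: le_trans (chop N a b _ a0 ab b1) _.
  rewrite mulrC -ler_pdivrMr//; apply: le_trans (ltW NE) _.
  by rewrite ler_nat.
have -> : expR (- (kappa * s)) * E ^+ n.+1 * weight Ck B m'.+1 0 a b =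
    Y * E1 * ((1 + e1) * weight Ck B m'.+1 0 a b) by rewrite exprSr /Y /E; ring.
rewrite lee_fin; apply: ler_wpM2l; first by rewrite mulr_ge0// ltW.
rewrite /weight Ck0 /cuts/= subn0 addr0 mulr1 [leRHS]mulrDr lerD2l ler_peMl//;
  last lra.
by rewrite mulr_ge0 ?exprn_ge0 ?ltW.
Qed.

End Tower.

(** * Critical points *)

Section FiniteUniform.
Context {R : realType}.

Lemma seq_gap (F : seq R) : exists2 r : R, 0 < r &
  forall x y, x \in F -> y \in F -> x != y -> r <= `|x - y|.
Proof.
elim: F => [|y F [r r0 Hr]]; first by exists 1.
have [q q0 Hq] : exists2 q : R, 0 < q & forall x, x \in F -> x != y -> q <= `|x - y|.
  elim: F {r r0 Hr} => [|z F [q q0 Hq]]; first by exists 1.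
  have [->|zy] := eqVneq z y.
    by exists q => // x; rewrite inE => /orP[/eqP -> /eqP//|]; exact: Hq.
  exists (Num.min q `|z - y|); first by rewrite lt_min q0 normr_gt0 subr_eq0.
  move=> x; rewrite inE ge_min => /orP[/eqP -> _|/Hq h /h ->//].
  by rewrite lexx orbT.
exists (Num.min r q); first by rewrite lt_min r0.
move=> u v; rewrite !inE ge_min => /orP[/eqP ->|uF] /orP[/eqP ->|vF] uv.
- by rewrite eqxx in uv.
- by rewrite distrC Hq ?orbT// eq_sym.
- by rewrite Hq ?orbT.
- by rewrite Hr.
Qed.

Lemma seq_uniform (T : eqType) (F : seq T) (P : T -> R -> Prop) :
  (forall x, x \in F -> exists2 d : R, 0 < d & forall e, 0 < e <= d -> P x e) ->
  exists2 d : R, 0 < d & forall x, x \in F -> forall e, 0 < e <= d -> P x e.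
Proof.
elim: F => [|y F IH] H; first by exists 1.
have [d d0 Hd] : exists2 d : R, 0 < d &
    forall x, x \in F -> forall e, 0 < e <= d -> P x e.
  by apply: IH => x xF; apply: H; rewrite inE xF orbT.
have [e e0 He] := H y (mem_head _ _).
exists (Num.min d e); first by rewrite lt_min d0.
move=> x; rewrite inE => xyF u; rewrite le_min => /andP[u0 /andP[ud ue]].
by case/orP: xyF => [/eqP ->|xF]; [apply: He|apply: Hd]; rewrite ?u0.
Qed.

Lemma seq_argmin (T : eqType) (g : T -> R) (y : T) (F : seq T) :
  exists2 x, x \in y :: F & forall z, z \in y :: F -> g x <= g z.
Proof.
elim: F => [|w F [x xF Hx]].
  by exists y; rewrite ?mem_head// => z; rewrite inE => /eqP ->.
have [gxw|gwx] := leP (g x) (g w).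
  exists x; first by move: xF; rewrite !inE => /orP[->|->]; rewrite ?orbT.
  move=> z; rewrite !inE => /or3P[/eqP ->|/eqP ->//|zF];
    apply: Hx; rewrite inE ?eqxx//.
  by rewrite zF orbT.
exists w; first by rewrite !inE eqxx orbT.
move=> z; rewrite !inE => /or3P[/eqP ->|/eqP ->//|zF];
  apply: (le_trans (ltW gwx)); apply: Hx; rewrite inE ?eqxx//.
by rewrite zF orbT.
Qed.

End FiniteUniform.

Section CriticalPoints.
Context {R : realType} (C : set R) (finC : finite_set C) (CI : C `<=` unitI).

(** Radii and constants of local estimates are made uniform over the finitely many
    critical points; upper bounds are encoded as inverses of the parameter. *)
Lemma crit_uniform (P : R * bool -> R -> Prop) :
  (forall c, critical_points C c ->
    exists2 d : R, 0 < d & forall e, 0 < e <= d -> P c e) ->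
  exists2 d : R, 0 < d &
    forall c, critical_points C c -> forall e, 0 < e <= d -> P c e.
Proof.
move=> H; have /finite_seqP[Cs CE] := finC.
have [|d d0 Hd] := @seq_uniform R _ [seq (u, v) | u <- Cs, v <- [:: true; false]]
    (fun c e => critical_points C c -> P c e).
  move=> c _; have [/H[d d0 Hd]|nc] := pselect (critical_points C c).
    by exists d => // e e0 _; exact: Hd.
  by exists 1.
exists d => // c cC e e0; apply: Hd => //.
case: c cC => x b [/= Cx _]; apply/flatten_mapP; exists x.
  by move: Cx; rewrite CE.
by case: b; rewrite !inE eqxx ?orbT.
Qed.

Lemma crit_mem x : C x -> exists b, critical_points C (x, b).
Proof.
move=> Cx; have /unitI_mem Ix := CI Cx.
by have [x1|x1] := ltP x 1; [exists true|exists false]; split=> //=; lra.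
Qed.

Lemma crit_side x t : C x -> unitI t -> t != x -> critical_points C (x, x < t).
Proof.
move=> Cx /unitI_mem It; rewrite neq_lt => tx; split=> //=.
have [xt|tx'] := ltP x t; first lra.
by move: tx; rewrite [x < t]ltNge tx' orbF; lra.
Qed.

Lemma dist_crit_le c t : critical_points C c -> dist_crit C t <= `|t - c.1|.
Proof.
move=> cC; apply: ge_inf; last by exists c.
by exists 0 => _ [c' _ <-].
Qed.

Lemma dist_crit_ge t x : C !=set0 ->
  (forall c, critical_points C c -> x <= `|t - c.1|) -> x <= dist_crit C t.
Proof.
move=> [y /crit_mem[b yC]] H; apply: lb_le_inf; first by exists `|t - y|, (y, b).
by move=> _ [c cC <-]; exact: H.
Qed.

Lemma dist_crit_argmin t : C !=set0 ->
  exists2 x, C x & dist_crit C t = `|t - x|.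
Proof.
move=> C0; have /finite_seqP[Cs CE] := finC.
case: Cs CE => [|y Cs] CE.
  by move: C0; rewrite CE => -[x]; rewrite /= in_nil.
have [x xC Hx] := seq_argmin (fun z => `|t - z|) y Cs.
have Cx : C x by rewrite CE.
exists x => //; apply/eqP; rewrite eq_le; apply/andP; split.
  by have [b bC] := crit_mem Cx; exact: (dist_crit_le _ bC).
apply: dist_crit_ge => // c [Cc _]; apply: Hx; move: Cc; rewrite CE; exact.
Qed.

(** The radius is half the smallest gap between the points of [C], 0 and 1. *)
Lemma crit_isolated : exists2 d : R, 0 < d &
  forall c, critical_points C c -> forall t, sided_nbhd c d t ->
    (unitI `\` C) t /\ dist_crit C t = `|t - c.1|.
Proof.
have /finite_seqP[Cs CE] := finC.
have [r r0 Hr] := seq_gap [:: 0, 1 & Cs].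
have Hr' c x : C c -> x \in [:: 0, 1 & Cs] -> x != c -> r <= `|x - c|.
  move=> Cc xF xc; apply: Hr => //; rewrite !inE; apply/orP; right; apply/orP; right.
  by move: Cc; rewrite CE.
exists (r / 2) => [|c cC t tc]; first lra.
have t0 := sided_nbhd_gt0 tc.
move/sided_nbhdP : tc => [tside td]; case: (cC) => Cc side.
have /unitI_mem Ic := CI Cc.
have Ct' x : C x -> x != c.1 -> r / 2 <= `|t - x|.
  move=> Cx xc; have : r <= `|x - c.1|.
    by apply: Hr' => //; rewrite !inE; move: Cx; rewrite CE => ->; rewrite !orbT.
  by have := ler_distD t x c.1; rewrite [`|x - t|]distrC; lra.
split; first split.
- apply/unitI_mem; move: tside side td; case: c.2 => tc c1.
    have : r <= `|1 - c.1|.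
      by apply: Hr' => //; rewrite ?inE ?eqxx ?orbT//; apply/eqP; lra.
    by rewrite !gtr0_norm ?subr_gt0//; lra.
  have : r <= `|0 - c.1|.
    by apply: Hr' => //; rewrite ?inE ?eqxx ?orbT//; apply/eqP; lra.
  by rewrite !ltr0_norm ?subr_lt0//; lra.
- move=> Ct; have := Ct' _ Ct; have [tc|tc /(_ isT)] := eqVneq t c.1.
    by move: t0; rewrite tc subrr normr0 ltxx.
  by rewrite subrr normr0; lra.
apply/eqP; rewrite eq_le dist_crit_le//=; apply: dist_crit_ge; first by exists c.1.
move=> c' [Cc' _]; have [->//|/(Ct' _ Cc')] := eqVneq c'.1 c.1; lra.
Qed.

End CriticalPoints.

(** * Expansion and distortion near singularities *)

Section LocalEstimates.
Context {R : realType} (f : R -> R) (C : set R) (alpha : R) (ord : R * bool -> R).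
Context (Hf : piecewise_C1holder alpha f C) (Hord : critical_orders alpha f C ord).
Local Notation df := (derive_in unitI f).
Local Notation S := (singularities C ord).

Lemma cut_finite : finite_set C. Proof. by case: Hf. Qed.
Lemma cut_unitI : C `<=` unitI. Proof. by case: Hf. Qed.

Lemma uncutI (a b : R) : a < b ->
  (forall t, a < t < b -> (unitI `\` C) t) -> uncut C a b.
Proof.
move=> ab H; split.
- rewrite leNgt; apply/negP => a0; pose t := (a + Num.min 0 b) / 2.
  have tab : a < t < b by rewrite /t minEle; case: ifP => h; lra.
  have [/unitI_mem] := H t tab.
  by rewrite /t minEle; case: ifP => h; lra.
- rewrite leNgt; apply/negP => a0; pose t := (b + Num.max 1 a) / 2.
  have tab : a < t < b by rewrite /t maxEle; case: ifP => h; lra.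
  have [/unitI_mem] := H t tab.
  by rewrite /t maxEle; case: ifP => h; lra.
- by move=> x /H[].
Qed.

Lemma sided_nbhd_itv (c : R * bool) (x : R) : 0 < x ->
  exists a b : R, a < b /\ sided_nbhd c x = `]a, b[%classic.
Proof.
move=> x0; rewrite /sided_nbhd; case: c.2.
  by exists c.1, (c.1 + x); split => //; lra.
by exists (c.1 - x), c.1; split => //; lra.
Qed.

Lemma itv_mean_value a b y z : a < b ->
  (forall t, a < t < b -> (unitI `\` C) t) -> a < y < b -> a < z < b ->
  exists2 w, a < w < b & `|f y - f z| = `|df w| * `|y - z|.
Proof.
move=> ab abC yab zab; have [->|yz] := eqVneq y z.
  by exists z; rewrite // !subrr normr0 mulr0.
have [w ww ->] := uncut_MVT_norm Hf (uncutI ab abC) yab zab yz.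
by exists w => //; case/orP: ww; lra.
Qed.

Lemma itv_expands a b G : a < b -> (forall t, a < t < b -> (unitI `\` C) t) ->
  (forall t, a < t < b -> 1 <= G * `|df t|) -> expands f G `]a, b[%classic.
Proof.
move=> ab abC HG y z; rewrite /= !in_itv/= => yab zab.
have [w wab ->] := itv_mean_value ab abC yab zab.
by rewrite mulrA ler_peMl//; exact: HG.
Qed.

Lemma power_ge1 (a e w x : R) : 0 < w -> w <= x -> x <= 1 -> 0 < e -> e <= 1 - a ->
  1 <= w `^ (a - 1) * x `^ e.
Proof.
move=> w0 wx x1 e0 ea; have x0 : 0 < x by exact: lt_le_trans wx.
rewrite /powR !gt_eqF// -expRD -[leLHS]expR0 ler_expR.
have lw : ln w <= ln x by rewrite ler_ln.
have lx : ln x <= 0 by exact: ln_le0.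
have : 0 <= (1 - a) * (ln x - ln w) by rewrite mulr_ge0//; lra.
have : 0 <= (1 - a - e) * (- ln x) by rewrite mulr_ge0//; lra.
nra.
Qed.

Lemma singular_bounds s : S s -> exists d m M : R, [/\ 0 < d, 0 < m & 0 < M] /\
  forall t, sided_nbhd s d t -> [/\ (unitI `\` C) t,
    `|f t - iter_lim f 1 s| <= M * `|t - s.1| `^ (ord s),
    m * `|t - s.1| `^ (ord s - 1) <= `|df t| &
    `|df t| <= M * `|t - s.1| `^ (ord s - 1)].
Proof.
move=> [sC _].
case: Hord => _ [H /(_ _ sC)[d [d0 [cf cdf _]]]].
have [[m1 [M1 [m10 c1]]] [m2 [M2 [m20 c2]]]] := (cf, cdf).
have [r r0 Hr] := crit_isolated cut_finite cut_unitI.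
exists (Num.min d r), m2, (`|M1| + `|M2| + 1); split.
  split=> //; first by rewrite lt_min d0.
move=> t tV.
have tVd : sided_nbhd s d t by apply: sided_nbhd_le tV; rewrite ge_min lexx.
have tVr : sided_nbhd s r t by apply: sided_nbhd_le tV; rewrite ge_min lexx orbT.
have /andP[_ c1t] := c1 _ tVd; have /andP[c2l c2r] := c2 _ tVd.
have [tI _] := Hr _ sC _ tVr.
have t0 := sided_nbhd_gt0 tV.
have p1 : 0 < `|t - s.1| `^ (ord s) by exact: powR_gt0.
have p2 : 0 < `|t - s.1| `^ (ord s - 1) by exact: powR_gt0.
move: c1t c2l c2r; rewrite ler_pdivrMr// ler_pdivlMr// ler_pdivrMr// => c1t c2l c2r.
have nM1 := ler_norm M1; have nM2 := ler_norm M2.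
have n1 := normr_ge0 M1; have n2 := normr_ge0 M2.
split => //.
  by apply: le_trans c1t _; apply: ler_wpM2r; [exact: ltW|lra].
by apply: le_trans c2r _; apply: ler_wpM2r; [exact: ltW|lra].
Qed.

(** The same [e] serves as radius, as exponent and as inverse of the constant, since
    each of the three may be decreased: lengths are at most 1. *)
Lemma singular_expansion : exists2 e : R, 0 < e < 1 &
  forall s, S s ->
  forall x, 0 < x <= e -> expands f (e^-1 * x `^ e) (sided_nbhd s x).
Proof.
have [|e e0 He] := @crit_uniform R C cut_finite (fun s e => S s ->
    forall x, 0 < x <= e -> expands f (e^-1 * x `^ e) (sided_nbhd s x)).
  move=> s _; have [sS|nS] := pselect (S s); last by exists 1.
  have [d [m [M [[d0 m0 M0] H]]]] := singular_bounds sS.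
  have [_ /andP[ord0 ord1]] := sS.
  exists (Num.min (Num.min d m) (1 - ord s)).
    by rewrite !lt_min d0 m0 subr_gt0.
  move=> e /andP[e0]; rewrite !le_min -andbA => /and3P[ed em eo] _ x /andP[x0 xe].
  have [a [b [ab Eab]]] := sided_nbhd_itv s x0.
  have V t : a < t < b -> sided_nbhd s x t by rewrite Eab /= in_itv.
  have Vd t : a < t < b -> sided_nbhd s d t.
    by move=> /V; apply: sided_nbhd_le; exact: le_trans ed.
  rewrite Eab; apply: itv_expands => // t tab; first by case: (H _ (Vd _ tab)).
  have [_ _ dft _] := H _ (Vd _ tab).
  have t0 := sided_nbhd_gt0 (V _ tab).
  have tx : `|t - s.1| <= x by have /sided_nbhdP[_ /ltW] := V _ tab.
  have x1 : x <= 1 by lra.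
  have := power_ge1 t0 tx x1 e0 eo.
  move=> h; apply: (le_trans h); rewrite [leRHS]mulrAC.
  apply: ler_wpM2r; first exact: powR_ge0.
  rewrite ler_pdivlMl//; apply: le_trans dft; apply: ler_wpM2r => //.
exists (Num.min e (1 / 2)); first by rewrite lt_min e0/= gt_min; lra.
move=> s sS x xe; have [sC _] := sS.
by apply: (He _ sC) => //; rewrite lt_min e0/= ge_min lexx; lra.
Qed.

(** A visit distorts lengths by a bounded factor only. If the interval is short
    compared with its distance to [s], then f' varies by a bounded factor on it.
    Otherwise its length is comparable to the distance [far] of its far end, and
    the bounds far^a for the length of the image and far^(1 - a) for the
    contraction of preimages multiply to [far]. *)
Lemma singular_distortion : exists2 e : R, 0 < e &
  forall s, S s -> forall a b, a < b -> `]a, b[%classic `<=` sided_nbhd s e ->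
  exists G : R, [/\ 0 < G, expands f G `]a, b[%classic &
    forall x y, a < x < b -> a < y < b -> G * `|f x - f y| <= e^-1 * (b - a)].
Proof.
have [|e e0 He] := @crit_uniform R C cut_finite (fun s e => S s ->
  forall a b, a < b -> `]a, b[%classic `<=` sided_nbhd s e ->
  exists G : R, [/\ 0 < G, expands f G `]a, b[%classic &
    forall x y, a < x < b -> a < y < b -> G * `|f x - f y| <= e^-1 * (b - a)]).
  move=> s _; have [sS|nS] := pselect (S s); last by exists 1.
  have [d [m [M [[d0 m0 M0] H]]]] := singular_bounds sS.
  have [_ /andP[ord0 ord1]] := sS.
  have M40 : 0 < m / (4 * M) by rewrite divr_gt0// mulr_gt0.
  exists (Num.min d (m / (4 * M))); first by rewrite lt_min d0.
  move=> e /andP[e0]; rewrite le_min => /andP[ed eK] _ a b ab sub.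
  have V t : a < t < b -> sided_nbhd s e t.
    by move=> tab; apply: sub; rewrite /= in_itv.
  have Vd t : a < t < b -> sided_nbhd s d t.
    by move=> /V; apply: sided_nbhd_le.
  have abC t : a < t < b -> (unitI `\` C) t by case/Vd/H.
  pose far := if s.2 then b - s.1 else s.1 - a.
  have near_far t : a < t < b -> far - (b - a) < `|t - s.1| < far.
    move=> tab; have /sided_nbhdP[] := V _ tab; rewrite /far.
    case: s.2 => ts _.
      by rewrite gtr0_norm ?subr_gt0//; lra.
    by rewrite ltr0_norm ?subr_lt0//; lra.
  pose mid := (a + b) / 2.
  have mab : a < mid < b by rewrite /mid; lra.
  have far0 : 0 < far.
    by have /andP[_] := near_far _ mab; apply: le_lt_trans.
  pose p := far `^ (1 - ord s).
  have p0 : 0 < p by exact: powR_gt0.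
  exists (m^-1 * p); split; first by rewrite mulr_gt0 ?invr_gt0.
    apply: itv_expands => // t tab.
    have [_ _ dft _] := H _ (Vd _ tab).
    have t0 := sided_nbhd_gt0 (V _ tab).
    have /andP[_ tf] := near_far _ tab.
    rewrite -mulrA ler_pdivlMl// mulr1.
    apply: le_trans (ler_wpM2l (ltW p0) dft).
    rewrite mulrCA ler_peMr ?(ltW m0)// /p /powR !gt_eqF//.
    rewrite -expRD -[leLHS]expR0 ler_expR.
    have : ln `|t - s.1| <= ln far by rewrite ler_ln ?posrE// ltW.
    move=> lnle; have : 0 <= (1 - ord s) * (ln far - ln `|t - s.1|).
      by rewrite mulr_ge0//; lra.
    lra.
  have K : 4 * M / m <= e^-1.
    rewrite -[4 * M / m]invrK lef_pV2 ?posrE ?invr_gt0 ?divr_gt0 ?mulr_gt0//.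
    by rewrite invf_div.
  suff main x y : a < x < b -> a < y < b -> p * `|f x - f y| <= 4 * M * (b - a).
    move=> x y xab yab; have := main x y xab yab => h.
    rewrite -mulrA ler_pdivrMl//; apply: (le_trans h).
    rewrite [leRHS]mulrA; apply: ler_wpM2r; first lra.
    by rewrite -ler_pdivrMl// mulrC.
  move=> xab yab; have [ff|ff] := leP far (2 * (b - a)).
    have bound t : a < t < b -> `|f t - iter_lim f 1 s| <= M * far `^ (ord s).
      move=> tab; have [_ ft _ _] := H _ (Vd _ tab); apply: le_trans ft _.
      apply: ler_wpM2l; first exact: ltW.
      apply: ge0_ler_powR; rewrite ?nnegrE ?(ltW ord0) ?(ltW far0)//.
      by case/andP: (near_far _ tab) => _ /ltW.
    have fxy : `|f x - f y| <= 2 * M * far `^ (ord s).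
      have := bound _ xab; have := bound _ yab.
      have := ler_distD (iter_lim f 1 s) (f x) (f y).
      rewrite [`|iter_lim f 1 s - f y|]distrC; lra.
    apply: le_trans (ler_wpM2l (ltW p0) fxy) _.
    have -> : p * (2 * M * far `^ (ord s)) = 2 * M * far.
      rewrite mulrCA; congr (_ * _).
      by rewrite /p /powR !gt_eqF// -expRD -mulrDl subrK mul1r lnK.
    have : 0 <= M * (2 * (b - a) - far) by rewrite mulr_ge0 ?(ltW M0)//; lra.
    lra.
  have [w wab ->] := itv_mean_value ab abC xab yab.
  have [_ _ _ dfw] := H _ (Vd _ wab).
  have /andP[w1 _] := near_far _ wab.
  have w2 : far / 2 < `|w - s.1| by lra.
  have xy : `|x - y| <= b - a by rewrite ler_norml; lra.
  have pw : p * `|w - s.1| `^ (ord s - 1) <= 2.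
    have w0 : 0 < `|w - s.1| by lra.
    rewrite -[leRHS]lnK ?posrE// /p /powR !gt_eqF// -expRD ler_expR.
    have l2 : 0 < ln (2 : R) by rewrite ln_gt0// ltr1n.
    have : ln (far / 2) <= ln `|w - s.1| by rewrite ler_ln ?posrE; lra.
    rewrite ln_div ?posrE// => h.
    have : 0 <= (1 - ord s) * (ln `|w - s.1| - (ln far - ln 2)).
      by rewrite mulr_ge0//; lra.
    have : 0 <= ord s * ln 2 by rewrite mulr_ge0// ltW.
    nra.
  rewrite mulrA.
  have pd : p * `|df w| <= 2 * M.
    apply: le_trans (ler_wpM2l (ltW p0) dfw) _.
    by rewrite mulrCA mulrC; apply: ler_wpM2r => //; exact: ltW.
  have h1 := ler_pM _ _ pd xy.
  apply: le_trans (h1 _ _) _; rewrite ?mulr_ge0 ?(ltW p0)//.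
  by apply: ler_wpM2r; lra.
exists e => // s sS; have [sC _] := sS.
by apply: (He _ sC) => //; rewrite e0 lexx.
Qed.

End LocalEstimates.

(** * Finite cut lists *)

Section PowerSmall.
Context {R : realType}.

Lemma power_small (p H theta : R) : 0 < p -> 0 < theta -> exists2 r : R, 0 < r &
  forall u, 0 <= u <= r -> H * u `^ p <= theta.
Proof.
move=> al0 th0.
pose q := theta / (`|H| + 1).
have H1 : 0 < `|H| + 1 by rewrite ltr_wpDl.
have q0 : 0 < q by rewrite divr_gt0.
exists (q `^ p^-1); first exact: powR_gt0.
move=> u /andP[u0 ur].
have ua : u `^ p <= q.
  have -> : q = (q `^ p^-1) `^ p.
    by rewrite -powRrM mulVf ?gt_eqF// powRr1// ltW.
  by apply: ge0_ler_powR; rewrite ?nnegrE ?powR_ge0 ?(ltW al0).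
have ua0 := powR_ge0 u p.
apply: (@le_trans _ _ ((`|H| + 1) * q)); last first.
  by rewrite /q mulrCA divff ?mulr1// gt_eqF.
apply: (@le_trans _ _ ((`|H| + 1) * u `^ p)).
  by apply: ler_wpM2r => //; have := ler_norm H; lra.
by apply: ler_wpM2l => //; exact: ltW.
Qed.

End PowerSmall.

Section CutLists.
Context {R : realType} (f : R -> R) (C : set R) (alpha : R) (ord : R * bool -> R).
Context (alpha01 : 0 < alpha < 1)
  (Hf : piecewise_C1holder alpha f C) (Hord : critical_orders alpha f C ord).
Local Notation df := (derive_in unitI f).
Local Notation S := (singularities C ord).

Definition small_oscillation (d theta a b : R) :=
  (forall t s, a < t < b -> S s -> ~ sided_nbhd s d t) ->
  forall x y, a < x < b -> a < y < b -> `|df x - df y| <= theta.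

(** At a point of [C] both sides are treated apart. A critical point of order 1 has
    f' Hoelder continuous on its side; an interval close to one of smaller order
    lies in a singular neighbourhood, which is excluded. *)
Lemma local_oscillation d theta x : 0 < d -> 0 < theta -> unitI x ->
  exists2 r : R, 0 < r & forall a b, a < b -> uncut C a b ->
    x - r <= a -> b <= x + r -> ~ (a < x < b) -> small_oscillation d theta a b.
Proof.
move=> d0 th0 Ix; have /andP[al0 _] := alpha01.
have [Cx|Cx] := pselect (C x); last first.
  have [_ _ _ /(_ x (conj Ix Cx))[H [r [r0 /= [_ Hr]]]] _] := Hf.
  have [q q0 Hq] := power_small H al0 th0.
  exists (Num.min r (q / 2)); first by rewrite lt_min r0 divr_gt0.
  move=> a b ab abC xa bx _ _ y z yab zab.
  have m1 : Num.min r (q / 2) <= r by rewrite ge_min lexx.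
  have m2 : Num.min r (q / 2) <= q / 2 by rewrite ge_min lexx orbT.
  have mem t : a < t < b -> ((unitI `\` C) `&` ball x r) t.
    move=> tab; split; first exact: uncutP abC tab.
    by rewrite /ball/= ltr_norml; lra.
  apply: le_trans (Hr _ _ (mem _ yab) (mem _ zab)) _; apply: Hq.
  by rewrite normr_ge0/= ler_norml; lra.
have [ordP [H0 HH]] := Hord.
have [q q0 Hq] := power_small H0 al0 th0.
have side c : critical_points C c -> c.1 = x -> exists2 r : R, 0 < r &
    forall a b, a < b -> (forall t, a < t < b -> sided_nbhd c r t) ->
    small_oscillation d theta a b.
  move=> cC cx; have [e [e0 [_ _ Hh]]] := HH _ cC.
  have /andP[oc0] := ordP _ cC; rewrite le_eqVlt => /orP[/eqP oc1|oc1].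
    exists (Num.min e (q / 2)); first by rewrite lt_min e0 divr_gt0.
    move=> a b ab V _ y z yab zab.
    have m1 : Num.min e (q / 2) <= e by rewrite ge_min lexx.
    have m2 : Num.min e (q / 2) <= q / 2 by rewrite ge_min lexx orbT.
    have Ve t : a < t < b -> sided_nbhd c e t by move/V; apply: sided_nbhd_le.
    apply: le_trans (Hh oc1 _ _ (Ve _ yab) (Ve _ zab)) _; apply: Hq.
    rewrite normr_ge0/=.
    have /sided_nbhdP[_ yc] := V _ yab; have /sided_nbhdP[_ zc] := V _ zab.
    by have := ler_distD c.1 y z; rewrite [`|c.1 - z|]distrC; lra.
  exists d => // a b ab V noV; exfalso.
  have mab : a < (a + b) / 2 < b by lra.
  apply: (noV _ c mab _ (V _ mab)); split=> //.
  by rewrite oc0.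
have sideT b0 : exists2 r : R, 0 < r &
    forall a b, a < b -> (critical_points C (x, b0)) ->
    (forall t, a < t < b -> sided_nbhd (x, b0) r t) ->
    small_oscillation d theta a b.
  have [cC|nC] := pselect (critical_points C (x, b0)); last by exists 1.
  by have [r r0 Hr] := side _ cC erefl; exists r => // a b ab _; exact: Hr.
have [r1 r10 Hr1] := sideT true; have [r2 r20 Hr2] := sideT false.
exists (Num.min r1 r2); first by rewrite lt_min r10.
move=> a b ab [a0 b1 _] xa bx nab.
have m1 : Num.min r1 r2 <= r1 by rewrite ge_min lexx.
have m2 : Num.min r1 r2 <= r2 by rewrite ge_min lexx orbT.
have [xlea|altx] := leP x a.
  apply: Hr1 => //; first by split=> //=; lra.
  by move=> t tab; apply/sided_nbhdP => /=; rewrite gtr0_norm ?subr_gt0; lra.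
have blex : b <= x by rewrite leNgt; apply/negP => xb; apply: nab; rewrite altx xb.
apply: Hr2 => //; first by split=> //=; lra.
by move=> t tab; apply/sided_nbhdP => /=; rewrite ltr0_norm ?subr_lt0; lra.
Qed.

(** Uniform continuity of f' on the branches away from the singularities, in the
    form of finitely many cuts: the centres and the end points of a finite cover
    of [unitI] by balls on which [local_oscillation] holds. *)
Lemma oscillation_cuts d theta : 0 < d -> 0 < theta ->
  exists F : seq R, forall a b, a < b -> uncut C a b ->
    (forall x, a < x < b -> x \notin F) -> small_oscillation d theta a b.
Proof.
move=> d0 th0.
pose good (p : R * R) := 0 < p.2 /\ forall a b, a < b -> uncut C a b ->
    p.1 - p.2 <= a -> b <= p.1 + p.2 -> ~ (a < p.1 < b) ->
    small_oscillation d theta a b.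
have : cover_compact (`[0, 1]%classic : set R).
  by rewrite -compact_cover; exact: segment_compact.
move=> /(_ _ good (fun p => ball p.1 p.2)) [].
- by move=> p _; exact: ball_open.
- move=> x Ix; have [r r0 Hr] := local_oscillation d0 th0 Ix.
  by exists (x, r) => //=; exact: ballxx.
move=> D Dgood Dcov.
exists (flatten [seq [:: p.1; p.1 - p.2; p.1 + p.2] | p <- finmap.enum_fset D]).
move=> a b ab abC noF.
pose m := (a + b) / 2.
have mab : a < m < b by rewrite /m; lra.
have [[a0 b1 _]] := abC.
have Im : `[0, 1]%classic m by rewrite /= in_itv/=; lra.
have [p pD] := Dcov _ Im; rewrite /ball/= ltr_norml => pm.
have [p2 Hp] := set_mem (Dgood _ pD).
have inF y : y \in [:: p.1; p.1 - p.2; p.1 + p.2] -> ~ (a < y < b).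
  by move=> yp /noF/negP; apply; apply/flatten_mapP; exists p.
apply: Hp => //.
- rewrite leNgt; apply/negP => lt; apply: (inF (p.1 - p.2)); last lra.
  by rewrite !inE eqxx orbT.
- rewrite leNgt; apply/negP => lt; apply: (inF (p.1 + p.2)); last lra.
  by rewrite !inE eqxx !orbT.
- by apply: inF; rewrite !inE eqxx.
Qed.

Context (sigma : R) (sigma1 : 1 < sigma)
  (Hexp : forall x, (unitI `\` C) x -> sigma <= `|df x|).

Lemma finite_preimage y : exists L : seq R,
  forall x, unitI x -> f x = y -> x \in [:: 0, 1 & L].
Proof.
have /finite_seqP[Cs CE] := cut_finite Hf.
suff [L HL] : exists L : seq R, forall x, 0 < x < 1 -> f x = y -> x \in L.
  exists L => x /unitI_mem Ix fx; rewrite !inE.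
  have [//|x0] := eqVneq x 0; have [//|x1] := eqVneq x 1.
  by apply: HL => //; rewrite !lt_neqAle eq_sym x0 x1.
have main : forall a b : R, a <= b -> 0 <= a -> b <= 1 ->
    exists L : seq R, forall x, a < x < b -> f x = y -> x \in L.
  apply: (@split_ind _ Cs (fun a b => 0 <= a -> b <= 1 ->
    exists L : seq R, forall x, a < x < b -> f x = y -> x \in L)).
    move=> a b ab noC a0 b1.
    have abC : uncut C a b by split=> // x /noC /negP; rewrite CE.
    have [[x [xab fx]]|nx] := pselect (exists x, a < x < b /\ f x = y).
      exists [:: x] => z zab fz; rewrite inE; apply/eqP.
      by apply: (uncut_inj Hf sigma1 Hexp abC zab xab); rewrite fz.
    by exists [::] => z zab fz; exfalso; apply: nx; exists z.
  move=> a x b axb _ Hax Hxb a0 b1.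
  have [||L1 H1] := Hax; [lra|lra|].
  have [||L2 H2] := Hxb; [lra|lra|].
  exists (x :: L1 ++ L2) => z zab fz; rewrite inE mem_cat.
  have [zx|xz|//] := ltgtP z x.
    by rewrite H1//; lra.
  by rewrite H2 ?orbT//; lra.
by apply: main.
Qed.

Lemma exists_cut_tower (cut : seq R) : exists Ck, cut_tower f cut Ck.
Proof.
have pull (F : seq R) : exists F' : seq R, [/\ uniq F', {subset cut <= F'} &
    forall x, unitI x -> f x \in F -> x \in F'].
  elim: F => [|y F [F' [uF' sF' pF']]].
    by exists (undup cut); split; rewrite ?undup_uniq// => x; rewrite mem_undup.
  have [L HL] := finite_preimage y.
  exists (undup ([:: 0, 1 & L] ++ F')); split; first exact: undup_uniq.
    by move=> x /sF' xF; rewrite mem_undup mem_cat xF orbT.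
  move=> x Ix; rewrite mem_undup mem_cat inE => /orP[/eqP/(HL _ Ix) ->//|].
  by move=> /(pF' _ Ix) ->; rewrite orbT.
have [g Hg] := choice pull.
exists (fun k => iter k g [::]); split => //.
- by case=> [//|k] /=; have [] := Hg (iter k g [::]).
- by move=> k x xc /=; have [_ + _] := Hg (iter k g [::]); apply.
- by move=> k x Ix fx /=; have [_ _] := Hg (iter k g [::]); apply.
Qed.

End CutLists.

(** * One step of the penalized recursion *)

Section SlowDepth.
Context {R : realType} (f : R -> R) (C : set R) (alpha : R) (ord : R * bool -> R).
Context (alpha01 : 0 < alpha < 1)
  (Hf : piecewise_C1holder alpha f C) (Hord : critical_orders alpha f C ord).
Local Notation df := (derive_in unitI f).
Local Notation S := (singularities C ord).
Local Notation lam := (@lebesgue_measure R).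
Context (sigma : R) (sigma1 : 1 < sigma)
  (Hexp : forall x, (unitI `\` C) x -> sigma <= `|df x|).

Definition near_singular (d t : R) := exists2 s, S s & sided_nbhd s d t.

Definition visit (d t : R) : R := if `[< near_singular d t >] then 1 else 0.

Definition depth (d d' t : R) : R :=
  if `[< near_singular d t /\ dist_crit C t < d' >] then - ln (dist_crit C t) else 0.

(** The penalty pays, through exp (- kappa * L), for the bounded distortion that each
    visit to the larger neighbourhoods may cause. *)
Definition penalized (L d d' t : R) := depth d d' t - L * visit d t.

Lemma birkhoff_penalized L d d' n t :
  birkhoff f (penalized L d d') n t =
  birkhoff f (depth d d') n t - L * birkhoff f (visit d) n t.
Proof. by rewrite /birkhoff mulr_sumr -sumrB. Qed.

Lemma visit_le1 d t : visit d t <= 1.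
Proof. by rewrite /visit; case: ifP. Qed.

Lemma depth_ge0 d d' t : d' <= 1 -> 0 <= depth d d' t.
Proof.
move=> d1; rewrite /depth; case: ifP => // /asboolP[_ dt].
by rewrite oppr_ge0 ln_le0//; lra.
Qed.

(** With these cuts an interval lies in a critical neighbourhood of radius [d] as
    soon as it meets it. *)
Definition fences (Cs : seq R) (d : R) : seq R :=
  Cs ++ [seq x + d | x <- Cs] ++ [seq x - d | x <- Cs].

Lemma nbhd_dichotomy (Cs cut : seq R) d a b : C = [set` Cs] -> 0 < d ->
  {subset fences Cs d <= cut} -> uncut [set` cut] a b ->
  (forall t s, a < t < b -> S s -> ~ sided_nbhd s d t) \/
  (exists2 s, S s & forall t, a < t < b -> sided_nbhd s d t).
Proof.
move=> CE d0 sub [_ _ abF].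
have [[t [s [tab sS ts]]]|H] :=
  pselect (exists t s, [/\ a < t < b, S s & sided_nbhd s d t]).
  right; exists s => // u uab.
  have sCs : s.1 \in Cs by have [[]] := sS; rewrite CE.
  have a1 : ~ (a < s.1 < b).
    by move=> /abF; apply; apply: sub; rewrite !mem_cat sCs.
  have a2 : ~ (a < s.1 + d < b).
    move=> /abF; apply; apply: sub; rewrite !mem_cat.
    by apply/orP; right; apply/orP; left; apply/mapP; exists s.1.
  have a3 : ~ (a < s.1 - d < b).
    move=> /abF; apply; apply: sub; rewrite !mem_cat.
    by apply/orP; right; apply/orP; right; apply/mapP; exists s.1.
  move/sided_nbhdP : ts => [side tsd]; apply/sided_nbhdP.
  case: s.2 side => side.
    have d1 : t - s.1 < d by rewrite gtr0_norm ?subr_gt0 in tsd.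
    have sa : s.1 <= a by rewrite leNgt; apply/negP => h; apply: a1; lra.
    have sb : b <= s.1 + d by rewrite leNgt; apply/negP => h; apply: a2; lra.
    by rewrite gtr0_norm ?subr_gt0; lra.
  have d1 : s.1 - t < d by rewrite ltr0_norm ?subr_lt0 ?opprB in tsd.
  have sb : b <= s.1 by rewrite leNgt; apply/negP => h; apply: a1; lra.
  have sa : s.1 - d <= a by rewrite leNgt; apply/negP => h; apply: a3; lra.
  by rewrite ltr0_norm ?subr_lt0; lra.
left=> t s tab sS ts; apply: H; exists t, s; split => //.
Qed.

(** Away from the singularities f' varies little, which gives the factor [E1], and
    the potential vanishes. In the neighbourhood of radius [d] of a singularity
    the penalty compensates the distortion, up to the points at distance less
    than [d'], where the potential is large; these form the negligible set. *)
Lemma penalized_step_bound (Cs cut : seq R) (e eK r d d' theta kappa L E1 : R) :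
  C = [set` Cs] -> {subset fences Cs d <= cut} ->
  (forall a b, a < b -> uncut C a b -> (forall x, a < x < b -> x \notin cut) ->
     small_oscillation f C ord d theta a b) ->
  (forall s, S s ->
    forall x, 0 < x <= e -> expands f (e^-1 * x `^ e) (sided_nbhd s x)) ->
  (forall s, S s -> forall a b, a < b -> `]a, b[%classic `<=` sided_nbhd s eK ->
    exists G : R, [/\ 0 < G, expands f G `]a, b[%classic &
      forall x y, a < x < b -> a < y < b -> G * `|f x - f y| <= eK^-1 * (b - a)]) ->
  (forall c, critical_points C c -> forall t, sided_nbhd c r t ->
    (unitI `\` C) t /\ dist_crit C t = `|t - c.1|) ->
  [/\ 0 < d', d' <= d, d' <= e, d <= eK & d <= r] ->
  [/\ 0 < theta, 0 < kappa < e, 0 <= L, expR (kappa * - L) * eK^-1 <= 1 &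
    (1 + theta) * (1 + theta) <= E1] ->
  forall a b, uncut [set` cut] a b -> a < b ->
  step_bound f sigma (penalized L d d') kappa E1
    (e^-1 * 2 `^ kappa / (1 - 2 `^ (kappa - e)) * d' `^ (e - kappa)) a b.
Proof.
move=> CE sub osc HE HK Hr [d'0 d'd d'e deK dr] [th0 /andP[k0 ke] L0 LK HE1].
move=> a b abF ab.
have e0 : 0 < e by exact: lt_trans ke.
have d0 : 0 < d by exact: lt_le_trans d'd.
have s0 : 0 < sigma by exact: lt_trans sigma1.
have abC : uncut C a b.
  case: abF => a0 b1 H; split => // x /H; rewrite CE => nx xC.
  by apply/nx/sub; rewrite mem_cat xC.
have abI t : a < t < b -> (unitI `\` C) t by exact: uncutP abC.
have sE := uncut_expands Hf sigma1 Hexp abC.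
have min_expands G A : expands f G A -> expands f sigma^-1 A ->
    expands f (Num.min G sigma^-1) A.
  by move=> h1 h2; rewrite minEle; case: ifP.
have E11 : 1 <= E1 by have := mulr_gt0 th0 th0; lra.
case: (nbhd_dichotomy CE d0 sub abF) => [noV|[s sS V]].
  pose mid := (a + b) / 2.
  have mab : a < mid < b by rewrite /mid; lra.
  have abcut x : a < x < b -> x \notin cut.
    by case: abF => _ _ H xab; apply/negP; exact: H.
  have df1 t : a < t < b -> 1 < `|df t| by move=> /abI/Hexp; exact: lt_le_trans.
  have dfle x y : a < x < b -> a < y < b -> `|df x| <= (1 + theta) * `|df y|.
    move=> xab yab; have := osc _ _ ab abC abcut noV _ _ xab yab.
    have := ler_distD 0 (df x) (df y); have := ler_normB (df x - df y) (- df y).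
    rewrite opprK subrK normrN => h _ h2; have := df1 _ yab => h3.
    have : 0 <= theta * (`|df y| - 1) by rewrite mulr_ge0 ?(ltW th0)//; lra.
    lra.
  have dm := df1 _ mab.
  have dm0 : 0 < `|df mid| by lra.
  have Gp : 0 < (1 + theta) / `|df mid| by rewrite divr_gt0//; lra.
  exists (Num.min ((1 + theta) / `|df mid|) sigma^-1), 0, set0; split; split => //.
  - by rewrite lt_min Gp invr_gt0.
  - by rewrite -ler_pdivlMr// div1r ge_min lexx orbT.
  - apply: min_expands => //; apply: itv_expands Hf _ _ _ ab abI _ => t tab.
    by rewrite mulrAC ler_pdivlMr// mul1r; exact: dfle.
  - move=> x y xab yab; rewrite mulr0 expR0 mul1r.
    have [w wab ->] := itv_mean_value Hf ab abI xab yab.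
    have xy : `|x - y| <= b - a by rewrite ler_norml; lra.
    apply: (@le_trans _ _ ((1 + theta) / `|df mid| * (`|df w| * `|x - y|))).
      by apply: ler_wpM2r; [rewrite mulr_ge0|rewrite ge_min lexx].
    rewrite mulrA; apply: ler_pM => //.
      by rewrite mulr_ge0// ltW.
    apply: le_trans HE1; rewrite -mulrA; apply: ler_wpM2l; first lra.
    by rewrite ler_pdivrMl// mulrC; exact: dfle.
  - move=> t tab; left; rewrite /penalized /depth /visit.
    rewrite ifF; last by apply/asboolP => -[[s sS ts] _]; exact: noV tab sS ts.
    rewrite ifF; last by apply/asboolP => -[s sS ts]; exact: noV tab sS ts.
    by rewrite mulr0 subr0.
  - apply: negligible_set0; rewrite !mulr_ge0 ?powR_ge0 ?invr_ge0 ?(ltW e0)//.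
    have ln2 : 0 < ln (2 : R) by rewrite ln_gt0// ltr1n.
    rewrite subr_ge0 /powR pnatr_eq0/= -[leRHS]expR0 ler_expR.
    by rewrite mulr_le0_ge0//; [lra|exact: ltW].
have sC : critical_points C s by case: sS.
have subK : `]a, b[%classic `<=` sided_nbhd s eK.
  by move=> t; rewrite /= in_itv/= => /V; exact: sided_nbhd_le.
have [G [G0 GE Gd]] := HK _ sS _ _ ab subK.
have Vr t : sided_nbhd s d' t -> dist_crit C t = `|t - s.1|.
  by move=> /(sided_nbhd_le (le_trans d'd dr))/(Hr _ sC)[].
have visit0 t : 0 <= L * visit d t by rewrite mulr_ge0// /visit; case: ifP.
exists (Num.min G sigma^-1), (- L), (sided_nbhd s d'); split; split => //.
- by rewrite lt_min G0 invr_gt0.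
- by rewrite -ler_pdivlMr// div1r ge_min lexx orbT.
- by rewrite oppr_le0.
- exact: min_expands.
- move=> x y xab yab.
  apply: (@le_trans _ _ (expR (kappa * - L) * (G * `|f x - f y|))).
    rewrite -mulrA; apply: ler_wpM2l; first exact: expR_ge0.
    by apply: ler_wpM2r => //; rewrite ge_min lexx.
  apply: (@le_trans _ _ (expR (kappa * - L) * (eK^-1 * (b - a)))).
    by apply: ler_wpM2l; [exact: expR_ge0|exact: Gd].
  by rewrite mulrA; apply: ler_wpM2r; [lra|exact: le_trans E11].
- move=> t tab; have Vt := V _ tab.
  have ns : near_singular d t by exists s.
  rewrite /penalized /depth /visit [X in L * X]ifT ?mulr1; last exact/asboolP.
  have [lt|ge] := ltP (dist_crit C t) d'.
    right; apply/sided_nbhdP; split; first by case/sided_nbhdP: Vt.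
    by have [_ <-] := Hr _ sC _ (sided_nbhd_le dr Vt).
  by left; rewrite ifF ?sub0r//; apply/asboolP => -[].
- apply: deep_negligible => //; first by rewrite k0.
  + by rewrite invr_gt0.
  + by move=> x /andP[x0 xd]; apply: HE => //; rewrite x0/=; exact: le_trans d'e.
  + move=> t Vt; have := visit0 t; have := Vr _ Vt => dt.
    rewrite /penalized /depth ifT ?dt; first lra.
    apply/asboolP; split; last by case/sided_nbhdP: Vt.
    by exists s => //; exact: sided_nbhd_le Vt.
  + move=> t /(sided_nbhd_le (le_trans d'd dr))/(Hr _ sC)[[It _] _].
    exact: unitI_stable Hf _ It.
Qed.

End SlowDepth.

(** * Slow recurrence to the singular set *)

Section SlowDepth2.
Context {R : realType} (f : R -> R) (C : set R) (alpha : R) (ord : R * bool -> R).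
Context (alpha01 : 0 < alpha < 1)
  (Hf : piecewise_C1holder alpha f C) (Hord : critical_orders alpha f C ord).
Local Notation df := (derive_in unitI f).
Local Notation S := (singularities C ord).
Local Notation lam := (@lebesgue_measure R).
Context (sigma : R) (sigma1 : 1 < sigma)
  (Hexp : forall x, (unitI `\` C) x -> sigma <= `|df x|).

(** The contraction of a visit tends to 0 with [d] whereas the number of cuts does
    not depend on [d], so that [k] can be chosen first to make [visits_rare]
    yield the rate 1 for the frequency [rho]. *)
Lemma frequent_visits_rare rho : 0 < rho -> exists2 d0 : R, 0 < d0 &
  forall d, 0 < d <= d0 -> forall n,
  (lam (unitI `&` high f (visit C ord d) n (rho * n%:R)) <= (expR (- n%:R))%:E)%E.
Proof.
move=> rho0; have /finite_seqP[Cs CE] := cut_finite Hf.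
have [e /andP[e0 e1] He] := singular_expansion Hf Hord.
pose N : R := 1 + (size (fences Cs (0:R)))%:R.
have N1 : 1 <= N by rewrite /N lerDl.
have N0 : 0 < N by lra.
pose k := (ln N + 1) / rho.
have lN : 0 <= ln N by rewrite ln_ge0.
have k0 : 0 <= k by rewrite divr_ge0 ?(ltW rho0)//; lra.
have [q q0 Hq] := power_small (expR k * e^-1) e0 (ltr01 : 0 < (1 : R)).
exists (Num.min e q); first by rewrite lt_min e0.
move=> d; rewrite le_min => /and3P[d0 de dq] n.
have main := @visits_rare R f C alpha Hf sigma sigma1 Hexp (visit C ord d)
  (fences Cs d) (e^-1 * d `^ e) k.
apply: le_trans (main _ _ _ _ _ _ n _) _ => //.
- by move=> x; rewrite CE /fences mem_cat => /= ->.
- exact: visit_le1.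
- move=> a b abF; have [noV|[s sS V]] := nbhd_dichotomy ord CE d0 (fun x => id) abF.
    left=> t tab; rewrite /visit ifF//.
    by apply/asboolP => -[s sS ts]; exact: noV tab sS ts.
  right; apply: (expands_sub (B := sided_nbhd s d)).
    by move=> t; rewrite /= in_itv/=; exact: V.
  by apply: He => //; rewrite d0.
- by rewrite mulr_ge0 ?invr_ge0 ?powR_ge0// ltW.
- by rewrite mulrA; apply: Hq; rewrite (ltW d0).
rewrite lee_fin.
have -> : 1 + (size (fences Cs d))%:R = N :> R.
  by rewrite /N /fences !size_cat !size_map.
rewrite -[N in N ^+ n]lnK ?posrE// -expRM_natl -expRD ler_expR.
have -> : - (k * (rho * n%:R)) = - ((ln N + 1) * n%:R).
  by rewrite /k mulrA divfK ?gt_eqF.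
by rewrite [n%:R * _]mulrC; lra.
Qed.

(** Bernoulli's inequality. *)
Lemma exists_expn_ge2 : exists m : nat, 2 <= sigma ^+ m.
Proof.
have s1 : 0 < sigma - 1 by rewrite subr_gt0.
have [m mE] : exists m : nat, 1 / (sigma - 1) < m%:R.
  by exists (Num.truncn (1 / (sigma - 1))).+1; rewrite truncnS_gt.
exists m.
have : 1 <= (sigma - 1) * m%:R.
  by rewrite mulrC -ler_pdivrMr// ltW.
suff : forall k : nat, 1 + (sigma - 1) * k%:R <= sigma ^+ k by move=> /(_ m); lra.
elim=> [|k IH]; first by rewrite mulr0 addr0 expr0.
rewrite exprS -natr1.
have k0 : 0 <= (k%:R : R) by [].
have : 0 <= (sigma - 1) * ((sigma - 1) * k%:R) by rewrite !mulr_ge0// ltW.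
have : sigma * (1 + (sigma - 1) * k%:R) <= sigma * sigma ^+ k.
  by rewrite ler_wpM2l//; lra.
nra.
Qed.

(** Either the visits are frequent, which is rare, or the penalty is at most half of
    [eps] and the penalized depth is large, which is rare by [weighted_growth]
    with a growth rate E close to 1. The constants are chosen in the order
    kappa, L, rho, d, the cuts and their tower, m, l, B, and finally d', so small
    that deep excursions are negligible against B. *)
Lemma slow_depth eps : 0 < eps -> exists d d' K xi : R,
  [/\ 0 < d', d' <= d, d' <= 1, 0 < xi & 0 < K] /\
  [/\ forall c, critical_points C c -> forall t, sided_nbhd c d t ->
        dist_crit C t = `|t - c.1| &
      forall n, (lam (unitI `&` high f (depth C ord d d') n (eps * n%:R)) <=
        (K * expR (- (xi * n%:R)))%:E)%E].
Proof.
move=> eps0; have /finite_seqP[Cs CE] := cut_finite Hf.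
have [r r0 Hr] := crit_isolated (cut_finite Hf) (cut_unitI Hf).
have [e /andP[e0 e1] He] := singular_expansion Hf Hord.
have [eK eK0 HK] := singular_distortion Hf Hord.
pose kappa := e / 2.
have k0 : 0 < kappa by rewrite /kappa; lra.
have ke : kappa < e by rewrite /kappa; lra.
pose L := `|ln eK| / kappa.
have L0 : 0 <= L by rewrite divr_ge0// ltW.
have LK : expR (kappa * - L) * eK^-1 <= 1.
  rewrite ler_pdivrMr// mul1r -[leRHS]lnK ?posrE// ler_expR /L mulrN mulrCA.
  by rewrite divff ?gt_eqF// mulr1 lerNl -normrN ler_norm.
pose rho := eps / (2 * (L + 1)).
have rho0 : 0 < rho by rewrite divr_gt0//; lra.
have Lrho : L * rho <= eps / 2.
  rewrite /rho mulrA ler_pdivrMr; last lra.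
  have -> : eps / 2 * (2 * (L + 1)) = L * eps + eps by field.
  by rewrite lerDl ltW.
have [d0 d00 Hd0] := frequent_visits_rare rho0.
have [d [[dgt0 dd0] [deK dr d1]]] : exists d : R,
    (0 < d /\ d <= d0) /\ [/\ d <= eK, d <= r & d <= 1].
  exists (Num.min (Num.min d0 eK) (Num.min r 1)).
  by rewrite !lt_min d00 eK0 r0 ltr01 !ge_min !lexx !orbT; do !split.
(* The growth rate (1 + e1')^3 is then exp (kappa eps / 4), half of what the tail
   bound at level eps / 2 gains. *)
pose e1' := expR (kappa * eps / 12) - 1.
have th0 : 0 < e1'.
  by rewrite /e1' subr_gt0 -[ltLHS]expR0 ltr_expR divr_gt0// mulr_gt0.
have [Fo osc] := oscillation_cuts alpha01 Hf Hord dgt0 th0.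
pose cut := fences Cs d ++ Fo.
have [Ck tower] := exists_cut_tower Hf sigma1 Hexp cut.
have [m sm] := exists_expn_ge2.
have [_ uCk _ _] := tower.
have [l l0 Hl] := short_cuts (uCk m).
pose B := e1' * l / 2.
have B0 : 0 < B by rewrite divr_gt0// mulr_gt0.
pose W := 1 + B * sigma ^+ m.
have W0 : 0 < W by rewrite ltr_pwDl// mulr_ge0 ?(ltW B0)//; lra.
pose c := e^-1 * 2 `^ kappa / (1 - 2 `^ (kappa - e)).
have ek0 : 0 < e - kappa by lra.
have [q q0 Hq] := power_small (c * W) ek0 (mulr_gt0 th0 B0).
have [d' [[d'0 d'q] [d'd d'e]]] : exists d' : R,
    (0 < d' /\ d' <= q) /\ (d' <= d /\ d' <= e).
  exists (Num.min (Num.min d e) q).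
  by rewrite !lt_min dgt0 e0 q0 !ge_min !lexx !orbT; do !split.
pose E1 := (1 + e1') * (1 + e1').
have E1ge : 1 + e1' <= E1 by rewrite ler_peMr//; lra.
have growth := @weighted_growth R f C alpha Hf sigma sigma1 Hexp
  (penalized C ord L d d') cut Ck m kappa E1 e1' B l (c * d' `^ (e - kappa)).
have Lam n s : (lam (unitI `&` high f (penalized C ord L d d') n s) <=
    (expR (- (kappa * s)) * ((E1 * (1 + e1')) ^+ n * W))%:E)%E.
  apply: growth => //.
  - by move=> x; rewrite CE /cut /fences !mem_cat => /= ->.
  - exact: ltW.
  - by rewrite /B mulrCA divff ?mulr1.
  - by rewrite mulrAC; apply: Hq; rewrite (ltW d'0).
  - apply: (@penalized_step_bound R f C alpha ord Hf sigma sigma1 Hexp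
      Cs cut e eK r d d' e1') => //.
    + by move=> x xF; rewrite mem_cat xF.
    + move=> a b ab abC noc; apply: osc => // x /noc; rewrite mem_cat negb_or.
      by case/andP.
    + by rewrite k0 ke.
exists d, d', (1 + W), (Num.min 1 (kappa * eps / 4)); split.
  split => //; first exact: le_trans d'd d1.
    by rewrite lt_min ltr01 divr_gt0// mulr_gt0.
  by rewrite addr_gt0.
split=> [p pC t tp|n]; first by case: (Hr _ pC t (sided_nbhd_le dr tp)).
have dd : 0 < d <= d0 by rewrite dgt0.
have n0 : 0 <= (n%:R : R) by [].
apply: (le_trans (lam_cover2 _ (Hd0 _ dd n) (Lam n (eps / 2 * n%:R)))).
  move=> t [It]; rewrite /high/= => ht.
  have [hv|hv] := leP (rho * n%:R) (birkhoff f (visit C ord d) n t).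
    by left; split.
  right; split => //; rewrite /high/= birkhoff_penalized.
  have : L * birkhoff f (visit C ord d) n t <= L * (rho * n%:R).
    by apply: ler_wpM2l => //; exact: ltW.
  have : L * rho * n%:R <= eps / 2 * n%:R by apply: ler_wpM2r.
  lra.
rewrite lee_fin mulrDl mul1r; apply: lerD.
  rewrite ler_expR lerN2 -[leRHS]mul1r ler_wpM2r// ge_min lexx//.
rewrite mulrA [leLHS]mulrC; apply: ler_wpM2l; first exact: ltW.
have -> : E1 * (1 + e1') = expR (kappa * eps / 4).
  by rewrite /E1 /e1' addrC subrK -!expRD; congr expR; field.
rewrite -expRM_natl -expRD ler_expR.
have : Num.min 1 (kappa * eps / 4) * n%:R <= (kappa * eps / 4) * n%:R.
  by rewrite ler_wpM2r// ge_min lexx orbT.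
nra.
Qed.

End SlowDepth2.

(** * From singularities to all critical points *)

Section Shadowing.
Context {R : realType} (f : R -> R) (C : set R) (alpha : R) (ord : R * bool -> R).
Context (Hf : piecewise_C1holder alpha f C) (Hord : critical_orders alpha f C ord).
Local Notation S := (singularities C ord).

Lemma one_sided_sided_nbhd (c : R * bool) (d : R) : 0 < d ->
  \forall t \near one_sided c, sided_nbhd c d t.
Proof.
case: c => x [] d0; rewrite /one_sided /sided_nbhd /=.
  near=> t; rewrite /= in_itv/=; apply/andP; split; near: t.
    exact: nbhs_right_gt.
  by apply: nbhs_right_lt; rewrite ltrDl.
near=> t; rewrite /= in_itv/=; apply/andP; split; near: t.
  by apply: nbhs_left_gt; rewrite ltrBlDr ltrDl.
exact: nbhs_left_lt.
Unshelve. all: by end_near. Qed.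

#[local] Instance one_sided_proper (c : R * bool) : ProperFilter (one_sided c).
Proof. by case: c => x []; rewrite /one_sided /=; exact: _. Qed.

Lemma iter_limE j c (y K d : R) : 0 < d -> 0 <= K ->
  (forall t, sided_nbhd c d t -> `|iter j f t - y| <= K * `|t - c.1|) ->
  iter_lim f j c = y.
Proof.
move=> d0 K0 H; rewrite /iter_lim; apply: cvg_lim => //.
apply/cvgrPdist_lt => e e0.
have ek : 0 < Num.min d (e / (K + 1)) by rewrite lt_min d0 divr_gt0//; lra.
apply: filterS (one_sided_sided_nbhd c ek) => t tV.
have /H ht : sided_nbhd c d t by apply: sided_nbhd_le tV; rewrite ge_min lexx.
have /sided_nbhdP[_ te] := tV.
have te' : `|t - c.1| * (K + 1) < e.
  rewrite -ltr_pdivlMr; last lra.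
  by apply: lt_le_trans te _; rewrite ge_min lexx orbT.
have t0 := normr_ge0 (t - c.1).
rewrite distrC; apply: le_lt_trans ht _; nra.
Qed.

Lemma iter_unitI j t : unitI t -> unitI (iter j f t).
Proof. by move=> It; elim: j => //= j; exact: unitI_stable Hf _. Qed.

(** At a critical point of order 1 the first iterate is Lipschitz on its side, and
    from then on the limits f^j(c) stay off [C], where [f] is Lipschitz. *)
Lemma orbit_lipschitz c T : critical_points C c -> ord c = 1 ->
  (forall j, (0 < j < T)%N -> ~ C (iter_lim f j c)) ->
  forall j, (j < T)%N -> exists K d : R, [/\ 0 < K, 0 < d &
    forall t, sided_nbhd c d t ->
      `|iter j.+1 f t - iter_lim f j.+1 c| <= K * `|t - c.1|].
Proof.
move=> cC oc offC; elim=> [_|j IH jT].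
  case: Hord => _ [H /(_ _ cC)[d [d0 [[m1 [M1 [m10 c1]]] _ _]]]].
  exists (`|M1| + 1), d; split => // t tV.
  have t0 := sided_nbhd_gt0 tV.
  have /andP[_] := c1 _ tV; rewrite oc powRr1// ler_pdivrMr// => h.
  apply: le_trans h _; apply: ler_wpM2r; first exact: ltW.
  by have := ler_norm M1; lra.
have [K [d [K0 d0 H]]] := IH (ltnW jT).
set y := iter_lim f j.+1 c in H *.
have yC : ~ C y by apply: offC; rewrite /= jT.
have [r r0 Hr] := crit_isolated (cut_finite Hf) (cut_unitI Hf).
have close e : 0 < e -> exists2 t, unitI t & `|iter j.+1 f t - y| < e.
  move=> e0; pose q := Num.min d (Num.min r (e / K)).
  have q0 : 0 < q by rewrite !lt_min d0 r0 divr_gt0.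
  have [t tV] := @filter_ex _ (one_sided c) _ _ (one_sided_sided_nbhd c q0).
  have /(Hr _ cC)[[It _] _] : sided_nbhd c r t.
    by apply: sided_nbhd_le tV; rewrite !ge_min lexx !orbT.
  have /H ht : sided_nbhd c d t by apply: sided_nbhd_le tV; rewrite !ge_min lexx.
  exists t => //; apply: le_lt_trans ht _; rewrite mulrC -ltr_pdivlMr//.
  have /sided_nbhdP[_ h] := tV; apply: lt_le_trans h _.
  by rewrite !ge_min lexx !orbT.
have Iy : unitI y.
  apply/unitI_mem; apply/andP; split; rewrite leNgt; apply/negP => h.
    have [|t It] := close (- y); first lra.
    have /unitI_mem := iter_unitI j.+1 It.
    by move=> /andP[i0 _]; rewrite gtr0_norm ?subr_gt0; lra.
  have [|t It] := close (y - 1); first lra.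
  have /unitI_mem := iter_unitI j.+1 It.
  by move=> /andP[_ i1]; rewrite ltr0_norm ?subr_lt0; lra.
have [K' [r' [K'0 r'0 Hl]]] :=
  derive_in_lipschitz (off_cut_derivable Hf (conj Iy yC)).
pose q := Num.min d (Num.min r (r' / K)).
have q0 : 0 < q by rewrite !lt_min d0 r0 divr_gt0.
have main t : sided_nbhd c q t -> `|iter j.+2 f t - f y| <= K' * K * `|t - c.1|.
  move=> tV.
  have /(Hr _ cC)[[It _] _] : sided_nbhd c r t.
    by apply: sided_nbhd_le tV; rewrite !ge_min lexx !orbT.
  have /H ht : sided_nbhd c d t by apply: sided_nbhd_le tV; rewrite !ge_min lexx.
  rewrite -mulrA iterS; apply: le_trans (Hl _ (iter_unitI _ It) _) _.
    apply: le_lt_trans ht _; rewrite mulrC -ltr_pdivlMr//.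
    have /sided_nbhdP[_ h] := tV; apply: lt_le_trans h _.
    by rewrite !ge_min lexx !orbT.
  by apply: ler_wpM2l => //; exact: ltW.
exists (K' * K), q; split => //; first by rewrite mulr_gt0.
have -> : iter_lim f j.+2 c = f y.
  by apply: (iter_limE q0 _ main); rewrite mulr_ge0// ltW.
exact: main.
Qed.

(** A point close to a critical point of order 1 shadows its orbit and arrives, after
    the time T <= T0, at a singularity that is equally near up to a constant
    factor, and on its side by the diffeomorphism hypothesis. For small [delta] the
    constant costs at most half of the depth. *)
Lemma critical_shadow : visits_singularities f C ord ->
  exists T0 : nat, forall d d', 0 < d' -> d' <= d -> d' <= 1 ->
    (forall c, critical_points C c -> forall t, sided_nbhd c d t ->
       dist_crit C t = `|t - c.1|) ->
    exists2 delta : R, 0 < delta & delta <= 4^-1 /\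
      forall c, critical_points C c -> forall t, sided_nbhd c (2 * delta) t ->
      exists2 i : nat, (i <= T0)%N &
        - ln `|t - c.1| <= 2 * depth C ord d d' (iter i f t).
Proof.
move=> [T0 [_ visits]]; exists T0 => d d' d'0 d'd d'1 Hd.
have depthE s t : S s -> sided_nbhd s d' t -> depth C ord d d' t = - ln `|t - s.1|.
  move=> sS tV; have tV' := sided_nbhd_le d'd tV.
  have sC : critical_points C s by case: sS.
  rewrite /depth (Hd _ sC _ tV') ifT//.
  by apply/asboolP; split; [exists s|case/sided_nbhdP: tV].
have [|q q0 Hq] := @crit_uniform R C (cut_finite Hf) (fun c delta =>
    forall t, sided_nbhd c (2 * delta) t ->
    exists2 i : nat, (i <= T0)%N &
      - ln `|t - c.1| <= 2 * depth C ord d d' (iter i f t)).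
  move=> c cC; have [cS|cS] := pselect (S c).
    exists (d' / 2); first lra.
    move=> e /andP[e0 ed] t tV; exists 0%N => //=.
    have {}tV : sided_nbhd c d' t by apply: sided_nbhd_le tV; lra.
    rewrite (depthE c)//; have /sided_nbhdP[_ td] := tV.
    by have : ln `|t - c.1| <= 0 by [apply: ln_le0; lra]; lra.
  have oc : ord c = 1.
    have [/(_ _ cC) /andP[oc0 oc1] _] := Hord.
    apply/eqP; rewrite eq_le oc1 leNgt; apply/negP => oc2; apply: cS.
    by split => //; rewrite oc0.
  have [T [/andP[T0' TT0] [s sS [limT off [e [d1 [e0 d10 [_ _ img _ _]]]]]]]] :=
    visits c (conj cC cS).
  have offC j : (0 < j < T)%N -> ~ C (iter_lim f j c).
    move=> /off[cj _ [dj dj0]] /(crit_mem (cut_unitI Hf))[b yb].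
    have := dist_crit_le (iter_lim f j c) yb.
    by rewrite dj /= subrr normr0 leNgt dj0.
  case: T T0' TT0 limT off img offC => // T _ TT0 limT _ img offC.
  have [K [d2 [K0 d20 HK]]] := orbit_lipschitz cC oc offC (ltnSn T).
  exists (Num.min (Num.min d1 d2) (Num.min (d' / K) (K ^- 2)) / 2).
    by rewrite divr_gt0// !lt_min d10 d20 divr_gt0// invr_gt0 exprn_gt0.
  move=> u /andP[u0]; rewrite ler_pdivlMr// mulrC !le_min.
  move=> /andP[/andP[ud1 ud2] /andP[ud' uK]].
  move=> t tV; exists T.+1 => //.
  have /sided_nbhdP[_ tu] := tV.
  have t0 := sided_nbhd_gt0 tV.
  have h1 := HK _ (sided_nbhd_le ud2 tV); rewrite limT in h1.
  have tK : K * `|t - c.1| < d'.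
    by rewrite mulrC -ltr_pdivlMr//; exact: lt_le_trans ud'.
  have tS : sided_nbhd s d' (iter T.+1 f t).
    have /sided_nbhdP[side _] : sided_nbhd s e (iter T.+1 f t).
      by apply: img; exists t => //; exact: sided_nbhd_le ud1 _ tV.
    by apply/sided_nbhdP; split => //; exact: le_lt_trans h1 tK.
  rewrite (depthE s)//.
  have ft0 := sided_nbhd_gt0 tS.
  have lle : ln `|iter T.+1 f t - s.1| <= ln K + ln `|t - c.1|.
    by rewrite -lnM ?posrE// ler_ln ?posrE// mulr_gt0.
  have : ln `|t - c.1| <= - (2 * ln K).
    have -> : - (2 * ln K) = ln (K ^- 2).
      by rewrite lnV ?posrE ?exprn_gt0// lnXn// mulr_natl.
    rewrite ler_ln ?posrE ?invr_gt0 ?exprn_gt0//.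
    by apply: ltW; exact: lt_le_trans uK.
  lra.
have q4 : 0 < Num.min q 4^-1 <= q by rewrite lt_min q0 invr_gt0 ge_min lexx/= ltr0n.
exists (Num.min q 4^-1); first by case/andP: q4.
split; first by rewrite ge_min lexx orbT.
by move=> c cC; exact: Hq.
Qed.

(** One factor 2 comes from [critical_shadow]; the other one from the range where the
    truncated distance interpolates: it is at least [delta] there, which is at
    least (2 delta)^2, so its logarithm is at most twice that of the distance. *)
Lemma log_trunc_dist_le d d' T0 delta t :
  C !=set0 -> d' <= 1 -> 0 < delta -> delta <= 4^-1 ->
  (forall c, critical_points C c -> forall t, sided_nbhd c (2 * delta) t ->
    exists2 i : nat, (i <= T0)%N &
      - ln `|t - c.1| <= 2 * depth C ord d d' (iter i f t)) ->
  unitI t ->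
  log_trunc_dist C delta t <=
    4 * \sum_(0 <= i < T0.+1) depth C ord d d' (iter i f t).
Proof.
move=> C0 d'1 del0 del4 shadow It.
have dep0 u : 0 <= depth C ord d d' u by exact: depth_ge0.
have sum0 : 0 <= \sum_(0 <= i < T0.+1) depth C ord d d' (iter i f t).
  by apply: sumr_ge0.
have [x Cx dx] := dist_crit_argmin (cut_finite Hf) (cut_unitI Hf) t C0.
rewrite /log_trunc_dist /trunc_dist dx; set r := `|t - x|.
have del4' : delta * 4 <= 1 by rewrite -ler_pdivlMr ?ltr0n// div1r.
have [r2|r2] : 2 * delta <= r \/ r < 2 * delta by case: leP; [left|right].
  rewrite ifF; last by apply/negbTE; rewrite -ltNge; lra.
  by rewrite ifF ?ln1 ?normr0 ?mulr_ge0//; apply/negbTE; rewrite -leNgt.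
have [r0|r0] := eqVneq r 0.
  by rewrite r0 (ltW del0) ln0// normr0 mulr_ge0.
have rgt0 : 0 < r by rewrite lt_neqAle eq_sym r0 /r normr_ge0.
have tx : t != x by move: r0; rewrite /r normr_eq0 subr_eq0.
have cC := crit_side Cx It tx.
have tV : sided_nbhd (x, x < t) (2 * delta) t.
  apply/sided_nbhdP; split => //=; case: (ltP x t) => // tx'.
  by rewrite lt_neqAle tx.
have [i iT hi] := shadow _ cC _ tV.
have hsum : depth C ord d d' (iter i f t) <=
    \sum_(0 <= i < T0.+1) depth C ord d d' (iter i f t).
  rewrite (big_cat_nat (n := i)) //=; last exact: leqW.
  by rewrite big_nat_recl//= addrCA lerDl addr_ge0// sumr_ge0.
suff : `|ln (if r <= delta then r
             else if r < 2 * delta then (1 - delta) / delta * r + 2 * delta - 1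
             else 1)| <= 2 * - ln r.
  by move: hi; rewrite -/r /=; lra.
have lr : ln r <= 0 by apply: ln_le0; lra.
rewrite r2; case: (leP r delta) => rd; first by rewrite ler0_norm//; lra.
set v := _ + _ - 1.
have vE : v = delta + (1 - delta) / delta * (r - delta).
  by rewrite /v; field; rewrite gt_eqF.
have dd : 0 < (1 - delta) / delta by rewrite divr_gt0//; lra.
have v1 : delta <= v by rewrite vE lerDl mulr_ge0//; [exact: ltW|lra].
have v2 : v <= 1.
  have : (1 - delta) / delta * (r - delta) <= (1 - delta) / delta * delta.
    by apply: ler_wpM2l; [exact: ltW|lra].
  by rewrite vE divfK ?gt_eqF//; lra.
have lv : ln v <= 0 by exact: ln_le0.
rewrite ler0_norm//.
have : ln delta <= ln v by rewrite ler_ln ?posrE//; lra.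
have : 2 * ln r <= ln delta.
  rewrite mulr_natl -lnXn// ler_ln ?posrE ?exprn_gt0//.
  have : r * r <= (2 * delta) * (2 * delta) by apply: ler_pM; lra.
  rewrite expr2; nra.
lra.
Qed.

Lemma sum_shift_le (g : R -> R) n T0 i t : (forall x, 0 <= g x) -> (i <= T0)%N ->
  \sum_(0 <= j < n) g (iter i f (iter j f t)) <= birkhoff f g (n + T0) t.
Proof.
move=> g0 iT; rewrite /birkhoff.
under eq_bigr do rewrite -iterD addnC.
rewrite -(subnK iT) addnA [X in _ <= X](big_cat_nat (n := i)) //=;
  last exact: leq_addl.
have -> : \sum_(i <= k < n + (T0 - i) + i) g (iter k f t) =
    \sum_(0 <= k < n + (T0 - i)) g (iter (k + i) f t).
  by rewrite -{1}[i]add0n big_addn addnK.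
rewrite [X in _ <= _ + X](big_cat_nat (n := n)) ?leq_addr//=.
by rewrite addrA [X in _ <= X]addrAC lerDr addr_ge0// sumr_ge0.
Qed.

End Shadowing.

Lemma limn_esup_le_eventually {R : realType} (u : (\bar R)^nat) (y : \bar R)
    (N : nat) :
  (forall n, (N <= n)%N -> (u n <= y)%E) -> (limn_esup u <= y)%E.
Proof.
move=> H; rewrite /limn_esup /limf_esup.
apply: (@le_trans _ _ (ereal_sup (u @` [set n | (N <= n)%N]))).
  apply: ereal_inf_lbound; exists [set n | (N <= n)%N] => //.
  by exists N.
by apply: ge_ereal_sup => _ [n Nn <-]; exact: H.
Qed.

Theorem theoremC (R : realType) (alpha : R) (f : R -> R) (C : set R)
    (ord : R * bool -> R) :
  0 < alpha < 1 ->
  piecewise_C1holder alpha f C ->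
  critical_orders alpha f C ord ->
  1 < inf [set `|derive_in unitI f x| | x in unitI `\` C] ->
  singularities C ord !=set0 ->
  visits_singularities f C ord ->
  forall eps : R, 0 < eps ->
  exists2 delta : R, 0 < delta &
  exists2 xi : R, 0 < xi &
  (limn_esup (fun n : nat => (n%:R^-1)%:E *
     lne (lebesgue_measure [set t : R | unitI t /\
       (eps < n%:R^-1 * \sum_(0 <= j < n) log_trunc_dist C delta (iter j f t))%R]))
   < (- xi)%:E)%E.
Proof.
move=> alpha01 Hf Hord; set sigma := inf _ => sigma1 S0 visits eps eps0.
have Hexp x : (unitI `\` C) x -> sigma <= `|derive_in unitI f x|.
  by move=> Ix; apply: ge_inf; [exists 0 => _ [z _ <-]|exists x].
have C0 : C !=set0 by have [s [[Cs _] _]] := S0; exists s.1.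
have [T0 shadow] := critical_shadow Hf Hord visits.
pose M : R := 4 * (T0.+1)%:R.
have M0 : 0 < M by rewrite mulr_gt0.
have M20 : 0 < 2 * M by rewrite mulr_gt0.
have [d [d' [K [xi [[d'0 d'd d'1 xi0 K0] [Hd slow]]]]]] :=
  slow_depth alpha01 Hf Hord sigma1 Hexp (divr_gt0 eps0 M20).
have [delta del0 [del4 Hdel]] := shadow _ _ d'0 d'd d'1 Hd.
exists delta => //; exists (xi / 4); first by rewrite divr_gt0.
have dep0 u : 0 <= depth C ord d d' u by exact: depth_ge0.
pose bad n := [set t : R | unitI t /\
  (eps < n%:R^-1 * \sum_(0 <= j < n) log_trunc_dist C delta (iter j f t))%R].
have badh n : (T0 < n)%N -> bad n `<=`
    unitI `&` high f (depth C ord d d') (n + T0) (eps / (2 * M) * (n + T0)%:R).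
  move=> Tn t [It ht]; split => //; rewrite /high/=.
  have n0 : 0 < (n%:R : R) by rewrite ltr0n; exact: leq_trans Tn.
  have sumle : \sum_(0 <= j < n) log_trunc_dist C delta (iter j f t) <=
      M * birkhoff f (depth C ord d d') (n + T0) t.
    apply: (@le_trans _ _ (\sum_(0 <= j < n) 4 *
        \sum_(0 <= i < T0.+1) depth C ord d d' (iter i f (iter j f t)))).
      apply: ler_sum => j _; apply: (log_trunc_dist_le Hf C0 d'1 del0 del4 Hdel).
      exact: iter_unitI Hf _ _ It.
    rewrite -mulr_sumr /M -mulrA; apply: ler_wpM2l => //.
    rewrite exchange_big_nat/= mulrC mulr_natr -[X in _ *+ X]subn0 -sumr_const_nat.
    rewrite big_seq_cond [leRHS]big_seq_cond; apply: ler_sum => i.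
    rewrite andbT mem_index_iota ltnS /= => iT; exact: sum_shift_le.
  move: ht; rewrite mulrC ltr_pdivlMr// => /lt_le_trans/(_ sumle) h.
  have nT : ((n + T0)%:R : R) <= 2 * n%:R.
    by rewrite -natrM ler_nat mul2n -addnn leq_add2l ltnW.
  rewrite mulrAC ler_pdivrMr ?mulr_gt0//.
  have : eps * (n + T0)%:R <= eps * (2 * n%:R) by apply: ler_wpM2l => //; exact: ltW.
  nra.
have [N NE] : exists N : nat, `|ln K| / (xi / 2) < N%:R.
  by exists (Num.truncn (`|ln K| / (xi / 2))).+1; rewrite truncnS_gt.
apply: (@le_lt_trans _ _ (- (xi / 2))%:E); last by rewrite lte_fin ltrN2; lra.
apply: (limn_esup_le_eventually (N := maxn T0.+1 N)) => n.
rewrite geq_max => /andP[Tn Nn].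
have n0 : 0 < (n%:R : R) by rewrite ltr0n; exact: leq_trans Tn.
have small : (lebesgue_measure (bad n) <= (K * expR (- (xi * n%:R)))%:E)%E.
  apply: le_trans (lam_le (badh _ Tn)) _; apply: le_trans (slow _) _.
  rewrite lee_fin ler_pM2l// ler_expR lerN2 ler_pM2l// ler_nat; exact: leq_addr.
have Kn0 : 0 < K * expR (- (xi * n%:R)) by rewrite mulr_gt0 ?expR_gt0.
have lnsmall : (lne (lebesgue_measure (bad n)) <= (ln K - xi * n%:R)%:E)%E.
  have -> : (ln K - xi * n%:R)%:E = lne (K * expR (- (xi * n%:R)))%:E.
    by rewrite lne_EFin// lnM ?posrE ?expR_gt0// expRK.
  rewrite lee_lne//; rewrite in_itv/= ?lam_ge0 ?leey//.
  by rewrite lee_fin (ltW Kn0).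
have ninv : (0 <= (n%:R^-1)%:E :> \bar R)%E by rewrite lee_fin invr_ge0 ltW.
apply: le_trans (lee_wpmul2l ninv lnsmall) _.
rewrite -EFinM lee_fin mulrC ler_pdivrMr// mulNr.
have : `|ln K| < n%:R * (xi / 2).
  rewrite -ltr_pdivrMr ?divr_gt0//; apply: lt_le_trans NE _; by rewrite ler_nat.
by have := ler_norm (ln K); nra.
Qed.
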